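(* Let $A$ be an associative unital ring and let $\mathcal{C}$ be a coseparable $A$-coring with a cointegral $\gamma$ and a grouplike element $g$. View $\mathcal{C}$ as a separable $A$-ring with product $cc'=\sum\gamma(c\otimes c'_{(1)})c'_{(2)}=\sum c_{(1)}\gamma(c_{(2)}\otimes c')$, let $\mathbf{M}_{\mathcal{C}}$ be the category of firm right modules of the $A$-ring $\mathcal{C}$, and view $A$ as a right $\mathcal{C}$-module with action $a\cdot c=\gamma(ga\otimes c)$. Let $$B=\{b\in A\;|\;\forall c\in\mathcal{C},\ \gamma(gb\otimes c)=b\gamma(g\otimes c)\},\qquad Q=\{q\in\mathcal{C}\;|\;\forall c\in\mathcal{C},\ qc=q\gamma(g\otimes c)\}.$$ Then: (1) $Q$ is a subring of $\mathcal{C}$ with a right unit $g$. (2) The functor $-\otimes_B A:\mathbf{M}_B\to\mathbf{M}_{\mathcal{C}}$ is fully faithful, i.e. the unit $\eta$ of the adjunction in which it is left adjoint to $M\mapsto M^{\mathcal{C}}_{g,\gamma}=\{m\in M\;|\;\forall c\in\mathcal{C},\ m\cdot c=m\gamma(g\otimes c)\}$, namely $\eta_N:N\to(N\otimes_B A)^{\mathcal{C}}_{g,\gamma}$, $n\mapsto n\otimes 1_A$, is an isomorphism. (3) $A$ as a right $\mathcal{C}$-module and $Q$ as a left $\mathcal{C}$-module are direct summands of $\mathcal{C}^n$ for some (finite) $n\in\mathbb{N}$. (4) $A$ is a generator as a left $B$-module and $Q$ is a generator as a right $B$-module.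
   Context: Corings. $A$ is an associative ring with unit. An $A$-coring is an $(A,A)$-bimodule $\mathcal{C}$ with $(A,A)$-bimodule maps $\Delta_{\mathcal{C}}:\mathcal{C}\to\mathcal{C}\otimes_A\mathcal{C}$, written $\Delta_{\mathcal{C}}(c)=\sum c_{(1)}\otimes c_{(2)}$, and $\epsilon_{\mathcal{C}}:\mathcal{C}\to A$, satisfying coassociativity and counitality. It is coseparable if $\Delta_{\mathcal{C}}$ has a $(\mathcal{C},\mathcal{C})$-bicomodule retraction; equivalently, if it has a cointegral, i.e. an $(A,A)$-bimodule map $\gamma:\mathcal{C}\otimes_A\mathcal{C}\to A$ such that for all $c,c'\in\mathcal{C}$, $\sum\gamma(c\otimes c'_{(1)})c'_{(2)}=\sum c_{(1)}\gamma(c_{(2)}\otimes c')$ and $\sum\gamma(c_{(1)}\otimes c_{(2)})=\epsilon_{\mathcal{C}}(c)$. A grouplike element is $g\in\mathcal{C}$ with $\Delta_{\mathcal{C}}(g)=g\otimes g$ and $\epsilon_{\mathcal{C}}(g)=1_A$. $A$-rings and modules. An $A$-ring is an $(A,A)$-bimodule $S$ with an associative $(A,A)$-bimodule map $S\otimes_A S\to S$ (no unit required); it is separable if the product has an $(S,S)$-bimodule section. A right module over an $A$-ring $S$ is a right $A$-module $M$ with an associative right $A$-module map $M\otimes_A S\to M$, $m\otimes s\mapsto m\cdot s$; morphisms are right $A$-linear maps commuting with the action. For a right $S$-module $M$ and a left $S$-module $N$, $M\otimes_S N$ is the cokernel of $M\otimes_A S\otimes_A N\to M\otimes_A N$, $m\otimes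 s\otimes n\mapsto m\cdot s\otimes n-m\otimes s\cdot n$. A right $S$-module $M$ is firm if the induced map $M\otimes_S S\to M$ is an isomorphism. $B$ is a (unital) subring of $A$, $Q$ is a left ideal of $\mathcal{C}$ and a $(\mathcal{C},B)$-bimodule, and $A$ is a $(B,\mathcal{C})$-bimodule. $\mathbf{M}_B$ is the category of right $B$-modules; the right $\mathcal{C}$-action on $N\otimes_B A$ is $(n\otimes a)\cdot c=n\otimes\gamma(ga\otimes c)$. Subrings of the non-unital ring $\mathcal{C}$ are not required to be unital. *)

(* Defs.v *)
From HB Require Import structures.
From mathcomp Require Import all_boot all_algebra.
From mathcomp.classical Require Import boolp.
From mathcomp.multinomials Require Import freeg.

Set Implicit Arguments.
Unset Strict Implicit.
Unset Printing Implicit Defensive.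

Import GRing.Theory.
Local Open Scope ring_scope.
Local Open Scope quotient_scope.

Reserved Notation "M ⊗[ R ] N" (at level 40, R at level 200, left associativity).
Reserved Notation "m ⊗ n" (at level 40, left associativity).
Reserved Notation "s ∗ t" (at level 40, left associativity).
Reserved Notation "m ◃ s" (at level 40, left associativity).
Reserved Notation "s ▹ m" (at level 40, left associativity).
Reserved Notation "\Sum_ ( x , y <- t ) F"
  (at level 36, F at level 36, x name, y name, t at level 200,
   format "\Sum_ ( x ,  y  <-  t )  F").

Section Cokernel.
Variables (V : zmodType) (X : V -> Prop).

Definition zgen : {pred V} := fun x =>
  `[< forall P : {pred V}, zmod_closed P -> (forall y, X y -> y \in P) ->
      x \in P >].

Fact zgen_zmod_closed : zmod_closed zgen.
Proof.
split=> [|x y /asboolP Px /asboolP Py]; apply/asboolP=> P Pz PX.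
  by case: Pz.
by case: (Pz) => _; apply; [apply: Px | apply: Py].
Qed.

HB.instance Definition _ := GRing.isZmodClosed.Build V zgen zgen_zmod_closed.

(* V modulo the subgroup generated by X. *)
Definition zquot : Type := Quotient.quot zgen.
HB.instance Definition _ := GRing.Zmodule.on zquot.

Definition zpi (x : V) : zquot := \pi_(Quotient.quot zgen) x.
Definition zrepr (q : zquot) : V := repr (q : Quotient.quot zgen).

Lemma zreprK q : zpi (zrepr q) = q.
Proof. exact: reprK. Qed.

Fact zpi_is_zmod_morphism : zmod_morphism zpi.
Proof. by move=> x y; rewrite /zpi raddfB. Qed.
HB.instance Definition _ := GRing.isZmodMorphism.Build V zquot zpi
  zpi_is_zmod_morphism.

Lemma zgen_in x : X x -> x \in zgen.
Proof. by move=> Xx; apply/asboolP=> P _; apply. Qed.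

Lemma zpi0 x : X x -> zpi x = 0.
Proof.
move=> /zgen_in Xx; rewrite -[RHS](raddf0 zpi); apply/eqP.
by rewrite /zpi -Quotient.idealrBE subr0.
Qed.

Lemma zpiD x y : zpi (x + y) = zpi x + zpi y. Proof. exact: raddfD. Qed.
Lemma zpiB x y : zpi (x - y) = zpi x - zpi y. Proof. exact: raddfB. Qed.

Lemma zpi_eq x y : X (x - y) -> zpi x = zpi y.
Proof. by move=> /zpi0 /eqP; rewrite zpiB subr_eq0 => /eqP. Qed.

Lemma zpi_kernel (G : zmodType) (h : {additive V -> G}) :
  (forall x, X x -> h x = 0) -> forall x, h (zrepr (zpi x)) = h x.
Proof.
move=> hX x; apply/eqP; rewrite -subr_eq0 -raddfB; set d := _ - x.
have : d \in zgen.
  by rewrite Quotient.idealrBE; apply/eqP; exact: reprK.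
move=> /asboolP /(_ (fun x => h x == 0)) H; apply: H.
  split=> [|u v]; rewrite !unfold_in ?raddf0 ?raddfB //.
  by move=> /eqP -> /eqP ->; rewrite subr0.
by move=> y /hX hy; rewrite unfold_in; apply/eqP.
Qed.

End Cokernel.

(* A bimodule carries two scalings at once, so its right one cannot be the
   [lmodType R^c] structure on the same carrier: right modules are given their
   own structure. *)

HB.mixin Record Zmodule_isRmodule (R : pzRingType) M of GRing.Zmodule M := {
  rscale : M -> R -> M;
  rscaleA : forall x a b, rscale (rscale x a) b = rscale x (a * b);
  rscaler1 : forall x, rscale x 1 = x;
  rscaleDl : forall x y a, rscale (x + y) a = rscale x a + rscale y a;
  rscaleDr : forall x a b, rscale x (a + b) = rscale x a + rscale x b }.

#[short(type="rmodType")]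
HB.structure Definition Rmodule (R : pzRingType) :=
  {M of GRing.Zmodule M & Zmodule_isRmodule R M}.

Notation "x :* a" := (rscale x a) : ring_scope.

HB.mixin Record isBimodule (R S : pzRingType) M
    of GRing.Lmodule R M & Rmodule S M := {
  bscaleA : forall (a : R) (x : M) (b : S), (a *: x) :* b = a *: (x :* b) }.

#[short(type="bimodType")]
HB.structure Definition Bimodule (R S : pzRingType) :=
  {M of GRing.Lmodule R M & Rmodule S M & isBimodule R S M}.

Section RmoduleTheory.
Variables (R : pzRingType) (M : rmodType R).
Lemma rscale0l a : (0 : M) :* a = 0.
Proof. by apply: (addrI (0 :* a)); rewrite -rscaleDl !addr0. Qed.
Lemma rscaleNl (x : M) a : (- x) :* a = - (x :* a).
Proof. by apply: (addrI (x :* a)); rewrite -rscaleDl !subrr rscale0l. Qed.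
Lemma rscaleBl (x y : M) a : (x - y) :* a = x :* a - y :* a.
Proof. by rewrite rscaleDl rscaleNl. Qed.
Lemma rscaler0 (x : M) : x :* (0 : R) = 0.
Proof. by apply: (addrI (x :* (0 : R))); rewrite -rscaleDr !addr0. Qed.
Lemma rscaleNr (x : M) (a : R) : x :* (- a) = - (x :* a).
Proof. by apply: (addrI (x :* a)); rewrite -rscaleDr !subrr rscaler0. Qed.
Lemma rscaleBr (x : M) (a b : R) : x :* (a - b) = x :* a - x :* b.
Proof. by rewrite rscaleDr rscaleNr. Qed.
End RmoduleTheory.

Section RegularBimodule.
Variable R : pzRingType.
HB.instance Definition _ := Zmodule_isRmodule.Build R R^o
  (fun x a b => esym (mulrA x a b)) (@mulr1 R) (fun x y a => mulrDl x y a)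
  (fun x a b => mulrDr x a b).
HB.instance Definition _ := isBimodule.Build R R R^o
  (fun a x b => esym (mulrA a x b)).
End RegularBimodule.

Section RmoduleProd.
Variables (R : pzRingType) (M N : rmodType R).
Definition prod_rscale (x : M * N) (a : R) : M * N := (x.1 :* a, x.2 :* a).
Fact prod_rscaleA x a b :
  prod_rscale (prod_rscale x a) b = prod_rscale x (a * b).
Proof. by rewrite /prod_rscale !rscaleA. Qed.
Fact prod_rscaler1 x : prod_rscale x 1 = x.
Proof. by case: x => x y; rewrite /prod_rscale !rscaler1. Qed.
Fact prod_rscaleDl x y a :
  prod_rscale (x + y) a = prod_rscale x a + prod_rscale y a.
Proof. by rewrite /prod_rscale !rscaleDl. Qed.
Fact prod_rscaleDr x a b :
  prod_rscale x (a + b) = prod_rscale x a + prod_rscale x b.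
Proof. by rewrite /prod_rscale !rscaleDr. Qed.
HB.instance Definition _ := Zmodule_isRmodule.Build R (M * N)%type
  prod_rscaleA prod_rscaler1 prod_rscaleDl prod_rscaleDr.
End RmoduleProd.

Section RmodulePow.
Variables (R : pzRingType) (I : finType) (M : rmodType R).
Definition ffun_rscale (x : {ffun I -> M}) (a : R) : {ffun I -> M} :=
  [ffun i => x i :* a].
Fact ffun_rscaleA x a b :
  ffun_rscale (ffun_rscale x a) b = ffun_rscale x (a * b).
Proof. by apply/ffunP=> i; rewrite !ffunE rscaleA. Qed.
Fact ffun_rscaler1 x : ffun_rscale x 1 = x.
Proof. by apply/ffunP=> i; rewrite !ffunE rscaler1. Qed.
Fact ffun_rscaleDl x y a :
  ffun_rscale (x + y) a = ffun_rscale x a + ffun_rscale y a.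
Proof. by apply/ffunP=> i; rewrite !ffunE rscaleDl. Qed.
Fact ffun_rscaleDr x a b :
  ffun_rscale x (a + b) = ffun_rscale x a + ffun_rscale x b.
Proof. by apply/ffunP=> i; rewrite !ffunE rscaleDr. Qed.
HB.instance Definition _ := Zmodule_isRmodule.Build R {ffun I -> M}
  ffun_rscaleA ffun_rscaler1 ffun_rscaleDl ffun_rscaleDr.
End RmodulePow.

Record rhom (R : pzRingType) (M N : rmodType R) := RHom {
  rhom_fun :> M -> N;
  rhomD : forall x y, rhom_fun (x + y) = rhom_fun x + rhom_fun y;
  rhomZ : forall x a, rhom_fun (x :* a) = rhom_fun x :* a }.

Record bihom (R S : pzRingType) (M N : bimodType R S) := BiHom {
  bihom_fun :> M -> N;
  bihomD : forall x y, bihom_fun (x + y) = bihom_fun x + bihom_fun y;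
  bihomZl : forall a x, bihom_fun (a *: x) = a *: bihom_fun x;
  bihomZr : forall x b, bihom_fun (x :* b) = bihom_fun x :* b }.

Section Tensor.
Variables (R : pzRingType) (M : rmodType R) (N : lmodType R).

Local Notation gen m n := (<< ((m, n) : M * N) >> : {freeg (M * N)%type / int}).

Inductive tensor_rel : {freeg (M * N)%type / int} -> Prop :=
| TensorDl m m' n : tensor_rel (gen (m + m') n - (gen m n + gen m' n))
| TensorDr m n n' : tensor_rel (gen m (n + n') - (gen m n + gen m n'))
| TensorZ m a n : tensor_rel (gen (m :* a) n - gen m (a *: n)).

Definition tensor : Type := zquot tensor_rel.
HB.instance Definition _ := GRing.Zmodule.on tensor.

Definition tens (m : M) (n : N) : tensor := zpi tensor_rel (gen m n).

(* The map induced on [tensor] by [f]: it sends the class of a formal sum of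
   pairs to the corresponding sum of values of [f]. It is meaningful, and
   independent of representatives, when [f] is balanced ([tliftE]). *)
Definition tlift (G : zmodType) (f : M -> N -> G) (t : tensor) : G :=
  fglift (fun p => f p.1 p.2 : zmodule G) (zrepr t).

Definition balanced (G : zmodType) (f : M -> N -> G) : Prop :=
  [/\ forall m m' n, f (m + m') n = f m n + f m' n,
      forall m n n', f m (n + n') = f m n + f m n'
    & forall m a n, f (m :* a) n = f m (a *: n)].

End Tensor.

Notation "M ⊗[ R ] N" := (@tensor R M N) : type_scope.
Notation "m ⊗ n" := (tens m n) : ring_scope.

(* Sweedler notation: if t = sum_i x_i ⊗ y_i then this is sum_i F x_i y_i. *)
Notation "\Sum_ ( x , y <- t ) F" := (tlift (fun x y => F) t) : ring_scope.

Section TensorTheory.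
Variables (R : pzRingType) (M : rmodType R) (N : lmodType R).
Implicit Types (m : M) (n : N) (t : M ⊗[R] N).

Lemma tensDl m m' n : (m + m') ⊗ n = m ⊗ n + m' ⊗ n.
Proof.
by rewrite /tens -zpiD; apply/zpi_eq/TensorDl.
Qed.

Lemma tensDr m n n' : m ⊗ (n + n') = m ⊗ n + m ⊗ n'.
Proof.
by rewrite /tens -zpiD; apply/zpi_eq/TensorDr.
Qed.

Lemma tensZ m a n : (m :* a) ⊗ n = m ⊗ (a *: n).
Proof. exact/zpi_eq/TensorZ. Qed.

Lemma tens0l n : (0 : M) ⊗ n = 0.
Proof. by apply: (addrI (0 ⊗ n)); rewrite -tensDl !addr0. Qed.

Lemma tensNl m n : (- m) ⊗ n = - (m ⊗ n).
Proof. by apply: (addrI (m ⊗ n)); rewrite -tensDl !subrr tens0l. Qed.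

Lemma tensMzl m n (k : int) : (m *~ k) ⊗ n = (m ⊗ n) *~ k.
Proof.
pose h (x : M) := x ⊗ n.
have hB : zmod_morphism h by move=> x y; rewrite /h tensDl tensNl.
pose H : {additive M -> _} := HB.pack h (GRing.isZmodMorphism.Build _ _ h hB).
exact: (raddfMz H).
Qed.

Lemma tensor_ind (P : M ⊗[R] N -> Prop) :
  (forall m n, P (m ⊗ n)) -> (forall x y, P x -> P y -> P (x + y)) ->
  forall t, P t.
Proof.
move=> Pt PD t; rewrite -[t]zreprK -[zrepr t]freeg_repr.
move: (FreegDefs.seq_of_prefreeg _).
elim=> [|[k [m n]] s IHs].
  have -> : [freeg [::]] = 0 :> {freeg (M * N)%type / int} by [].
  by rewrite raddf0 -(tens0l 0).
have -> : [freeg (k, (m, n)) :: s] =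
          << ((m, n) : M * N) >> *~ k + [freeg s] :> {freeg (M * N)%type / int}.
  apply/eqP/freeg_eqP=> x; rewrite coeffD.
  have -> (g : {freeg (M * N)%type / int}) : coeff x (g *~ k) = coeff x g *~ k.
    exact: raddfMz.
  by rewrite coeffU !coeff_Freeg precoeff_cons /= mul1r -mulrzr intz.
by rewrite raddfD raddfMz; apply: PD => //; rewrite -/(tens m n) -tensMzl.
Qed.

Section Lift.
Variables (G : zmodType) (f : M -> N -> G).

Let F : {freeg (M * N)%type / int} -> zmodule G :=
  fglift (fun p => f p.1 p.2 : zmodule G).
Let F_additive : zmod_morphism F. Proof. exact: lift_is_additive. Qed.
HB.instance Definition _ := GRing.isZmodMorphism.Build _ _ F F_additive.

Let FD x y : F (x + y) = F x + F y. Proof. exact: raddfD. Qed.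
Let FB x y : F (x - y) = F x - F y. Proof. exact: raddfB. Qed.

Let F_gen m n : F << (m, n) >> = f m n.
Proof. by rewrite /F liftU scale1r. Qed.

Hypothesis fB : balanced f.

Let F_ker x : tensor_rel x -> F x = 0.
Proof.
case: fB => fDl fDr fZ.
by case=> *; rewrite FB ?FD !F_gen ?fDl ?fDr ?fZ subrr.
Qed.

Lemma tliftE m n : tlift f (m ⊗ n) = f m n.
Proof. by rewrite /tlift -/F /tens (zpi_kernel F_ker) /= F_gen. Qed.

Lemma tliftB : zmod_morphism (tlift f).
Proof.
move=> x y; rewrite /tlift -/F -[x]zreprK -[y]zreprK.
by rewrite -zpiB !(zpi_kernel F_ker) /= FB.
Qed.

Lemma tliftD x y : tlift f (x + y) = tlift f x + tlift f y.
Proof.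
pose h : {additive _ -> _} := HB.pack (tlift f)
  (GRing.isZmodMorphism.Build _ _ (tlift f) tliftB).
exact: (raddfD h).
Qed.

End Lift.
End TensorTheory.

Lemma additive_int (G G' : zmodType) (h : G -> G') :
  (forall x y, h (x + y) = h x + h y) ->
  (h 0 = 0) * ((forall x, h (- x) = - h x) * (forall x k, h (x *~ k) = h x *~ k)).
Proof.
move=> hD; have h0 : h 0 = 0 by apply: (addrI (h 0)); rewrite -hD !addr0.
have hN x : h (- x) = - h x by apply: (addrI (h x)); rewrite -hD !subrr.
have hB : zmod_morphism h by move=> x y; rewrite hD hN.
pose H : {additive G -> G'} := HB.pack h (GRing.isZmodMorphism.Build _ _ h hB).
by do 2!split=> //; move=> x k; exact: (raddfMz H).
Qed.

Section TliftOps.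
Variables (R : pzRingType) (M : rmodType R) (N : lmodType R).
Implicit Types t : M ⊗[R] N.

Lemma tlift_sum (G : zmodType) (f : M -> N -> G) t :
  tlift f t = \sum_(p <- repr (zrepr t)) f p.2.1 p.2.2 *~ p.1.
Proof. by rewrite /tlift -[zrepr t in LHS]freeg_repr fglift_Freeg. Qed.

Lemma tlift_ext (G : zmodType) (f f' : M -> N -> G) t :
  (forall m n, f m n = f' m n) -> tlift f t = tlift f' t.
Proof. by move=> ff'; rewrite !tlift_sum; apply: eq_bigr => p _; rewrite ff'. Qed.

Lemma tlift_comp (G G' : zmodType) (h : G -> G') (f : M -> N -> G) t :
  (forall x y, h (x + y) = h x + h y) ->
  h (tlift f t) = tlift (fun m n => h (f m n)) t.
Proof.
move=> hD; rewrite !tlift_sum (big_morph h hD (additive_int hD).1).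
by apply: eq_bigr => p _; rewrite (additive_int hD).
Qed.

Lemma tlift_add (G : zmodType) (f f' : M -> N -> G) t :
  tlift (fun m n => f m n + f' m n) t = tlift f t + tlift f' t.
Proof.
by rewrite !tlift_sum -big_split; apply: eq_bigr => p _; rewrite mulrzDl.
Qed.

Lemma tlift_tens t : tlift (@tens R M N) t = t.
Proof.
have tB : balanced (@tens R M N).
  by split=> *; [exact: tensDl | exact: tensDr | exact: tensZ].
by elim/tensor_ind: t => [m n | x y xP yP]; rewrite ?tliftE ?tliftD ?xP ?yP.
Qed.

Lemma tensor_eq (G : zmodType) (h h' : M ⊗[R] N -> G) :
  (forall x y, h (x + y) = h x + h y) ->
  (forall x y, h' (x + y) = h' x + h' y) ->
  (forall m n, h (m ⊗ n) = h' (m ⊗ n)) -> forall t, h t = h' t.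
Proof.
move=> hD h'D hh'; elim/tensor_ind=> [m n|x y xP yP]; first exact: hh'.
by rewrite hD h'D xP yP.
Qed.

End TliftOps.

Section TensorRight.
Variables (R S : pzRingType) (M : rmodType R) (N : bimodType R S).

Definition tens_rscale (t : M ⊗[R] N) (b : S) : M ⊗[R] N :=
  \Sum_(m, n <- t) (m ⊗ (n :* b)).

Fact tens_rscale_balanced b : balanced (fun (m : M) (n : N) => m ⊗ (n :* b)).
Proof.
split=> [m m' n|m n n'|m a n]; first by rewrite tensDl.
  by rewrite rscaleDl tensDr.
by rewrite tensZ bscaleA.
Qed.

Lemma tens_rscaleE m n b : tens_rscale (m ⊗ n) b = m ⊗ (n :* b).
Proof. exact: (tliftE (tens_rscale_balanced b)). Qed.

Fact tens_rscaleDl x y b :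
  tens_rscale (x + y) b = tens_rscale x b + tens_rscale y b.
Proof. exact: (tliftD (tens_rscale_balanced b)). Qed.

Fact tens_rscaleA t a b : tens_rscale (tens_rscale t a) b = tens_rscale t (a * b).
Proof.
elim/tensor_ind: t => [m n|x y xP yP]; first by rewrite !tens_rscaleE rscaleA.
by rewrite !tens_rscaleDl xP yP.
Qed.

Fact tens_rscaler1 t : tens_rscale t 1 = t.
Proof.
elim/tensor_ind: t => [m n|x y xP yP]; first by rewrite tens_rscaleE rscaler1.
by rewrite tens_rscaleDl xP yP.
Qed.

Fact tens_rscaleDr t a b :
  tens_rscale t (a + b) = tens_rscale t a + tens_rscale t b.
Proof.
elim/tensor_ind: t => [m n|x y xP yP].
  by rewrite !tens_rscaleE rscaleDr tensDr.
by rewrite !tens_rscaleDl xP yP addrACA.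
Qed.

HB.instance Definition _ := Zmodule_isRmodule.Build S (tensor M N)
  tens_rscaleA tens_rscaler1 tens_rscaleDl tens_rscaleDr.

Lemma tensZr (m : M) (n : N) (b : S) : (m ⊗ n) :* b = m ⊗ (n :* b).
Proof. exact: tens_rscaleE. Qed.

End TensorRight.

Section TensorLeft.
Variables (T R : pzRingType) (M : bimodType T R) (N : lmodType R).

Definition tens_lscale (a : T) (t : M ⊗[R] N) : M ⊗[R] N :=
  \Sum_(m, n <- t) ((a *: m) ⊗ n).

Fact tens_lscale_balanced a : balanced (fun (m : M) (n : N) => (a *: m) ⊗ n).
Proof.
split=> [m m' n|m n n'|m b n]; first by rewrite scalerDr tensDl.
  by rewrite tensDr.
by rewrite -tensZ bscaleA.
Qed.

Lemma tens_lscaleE a m n : tens_lscale a (m ⊗ n) = (a *: m) ⊗ n.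
Proof. exact: (tliftE (tens_lscale_balanced a)). Qed.

Fact tens_lscaleDr a : {morph tens_lscale a : x y / x + y}.
Proof. exact: (tliftD (tens_lscale_balanced a)). Qed.

Fact tens_lscaleA a b t : tens_lscale a (tens_lscale b t) = tens_lscale (a * b) t.
Proof.
elim/tensor_ind: t => [m n|x y xP yP]; first by rewrite !tens_lscaleE scalerA.
by rewrite !tens_lscaleDr xP yP.
Qed.

Fact tens_lscale1 : left_id 1 tens_lscale.
Proof.
elim/tensor_ind=> [m n|x y xP yP]; first by rewrite tens_lscaleE scale1r.
by rewrite tens_lscaleDr xP yP.
Qed.

Fact tens_lscaleDl t : {morph tens_lscale^~ t : a b / a + b}.
Proof.
move=> a b; elim/tensor_ind: t => [m n|x y xP yP].
  by rewrite !tens_lscaleE scalerDl tensDl.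
by rewrite !tens_lscaleDr xP yP addrACA.
Qed.

HB.instance Definition _ := GRing.Zmodule_isLmodule.Build T (tensor M N)
  tens_lscaleA tens_lscale1 tens_lscaleDr tens_lscaleDl.

Lemma tensZl a (m : M) (n : N) : a *: (m ⊗ n) = (a *: m) ⊗ n.
Proof. exact: tens_lscaleE. Qed.

End TensorLeft.

Section TensorBimodule.
Variables (T R S : pzRingType) (M : bimodType T R) (N : bimodType R S).

Fact tens_bscaleA (a : T) (t : M ⊗[R] N) (b : S) :
  (a *: t) :* b = a *: (t :* b).
Proof.
elim/tensor_ind: t => [m n|x y xP yP].
  by rewrite tensZl !tensZr tensZl.
by rewrite scalerDr !rscaleDl scalerDr xP yP.
Qed.

HB.instance Definition _ := isBimodule.Build T S (tensor M N) tens_bscaleA.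

End TensorBimodule.

(* In [coassoc] the two sides are compared in C ⊗ (C ⊗ C); the left one is the
   image of (Δ ⊗ C) (Δ c) under (x ⊗ y) ⊗ z |-> x ⊗ (y ⊗ z). *)
Record coring (A : pzRingType) := Coring {
  coring_car :> bimodType A A;
  comul : bihom coring_car (coring_car ⊗[A] coring_car);
  counit : bihom coring_car A^o;
  coassoc : forall c,
    \Sum_(x, y <- comul c) (\Sum_(x1, x2 <- comul x) (x1 ⊗ (x2 ⊗ y)))
    = \Sum_(x, y <- comul c) (x ⊗ comul y);
  counitl : forall c, \Sum_(x, y <- comul c) ((counit x : A) *: y) = c;
  counitr : forall c, \Sum_(x, y <- comul c) (x :* (counit y : A)) = c }.

(* The existence of a cointegral is coseparability of C; it is carried as data
   since everything below depends on the choice of it. *)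
Record cointegral (A : pzRingType) (C : coring A) := Cointegral {
  cointegral_hom :> bihom (C ⊗[A] C) A^o;
  cointegral_colin : forall c c' : C,
    \Sum_(x, y <- comul C c') ((cointegral_hom (c ⊗ x) : A) *: y)
    = \Sum_(x, y <- comul C c) (x :* (cointegral_hom (y ⊗ c') : A));
  cointegral_norm : forall c : C, cointegral_hom (comul C c) = counit C c }.

Record grouplike (A : pzRingType) (C : coring A) := GroupLike {
  grouplike_elt :> C;
  grouplike_comul : comul C grouplike_elt = grouplike_elt ⊗ grouplike_elt;
  grouplike_counit : counit C grouplike_elt = 1 }.

Record aring (A : pzRingType) := ARing {
  aring_car :> bimodType A A;
  aring_mul : bihom (aring_car ⊗[A] aring_car) aring_car;
  aring_mulA : forall s t u,
    aring_mul (aring_mul (s ⊗ t) ⊗ u) = aring_mul (s ⊗ aring_mul (t ⊗ u)) }.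

Definition amul (A : pzRingType) (S : aring A) (s t : S) : S :=
  aring_mul S (s ⊗ t).
Notation "s ∗ t" := (amul s t) : ring_scope.

Record srmod (A : pzRingType) (S : aring A) := SRMod {
  srmod_car :> rmodType A;
  sract : rhom (srmod_car ⊗[A] S) srmod_car;
  sractA : forall m (s t : S), sract (sract (m ⊗ s) ⊗ t) = sract (m ⊗ (s ∗ t)) }.

Notation "m ◃ s" := (sract _ (m ⊗ s)) : ring_scope.

Record slmod (A : pzRingType) (S : aring A) := SLMod {
  slmod_car :> lmodType A;
  slact : {linear S ⊗[A] slmod_car -> slmod_car};
  slactA : forall (s t : S) m, slact (s ⊗ slact (t ⊗ m)) = slact ((s ∗ t) ⊗ m) }.

Notation "s ▹ m" := (slact _ (s ⊗ m)) : ring_scope.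

Record srhom (A : pzRingType) (S : aring A) (M N : srmod S) := SRHom {
  srhom_hom :> rhom M N;
  srhomM : forall (m : M) (s : S), srhom_hom (m ◃ s) = srhom_hom m ◃ s }.

Record slhom (A : pzRingType) (S : aring A) (M N : slmod S) := SLHom {
  slhom_hom :> {linear M -> N};
  slhomM : forall (s : S) (m : M), slhom_hom (s ▹ m) = s ▹ slhom_hom m }.

Lemma rhom_ext (R : pzRingType) (M N : rmodType R) (f h : rhom M N) :
  f =1 h -> f = h.
Proof.
case: f h => [f fD fZ] [h hD hZ] /= /funext fh; case: _ / fh in hD hZ *.
by congr RHom; exact: Prop_irrelevance.
Qed.

Lemma srhom_ext (A : pzRingType) (S : aring A) (M N : srmod S)
  (f h : srhom M N) : f =1 h -> f = h.
Proof.
case: f h => [f fM] [h hM] /= /rhom_ext fh; case: _ / fh in hM *.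
by congr SRHom; exact: Prop_irrelevance.
Qed.

Section RhomComp.
Variables (R : pzRingType) (L M N : rmodType R) (h : rhom M N) (f : rhom L M).

Fact rhom_compD x y : (h \o f) (x + y) = (h \o f) x + (h \o f) y.
Proof. by rewrite /= !rhomD. Qed.

Fact rhom_compZ x a : (h \o f) (x :* a) = (h \o f) x :* a.
Proof. by rewrite /= !rhomZ. Qed.

Definition rhom_comp : rhom L N := RHom rhom_compD rhom_compZ.

End RhomComp.

Section ModuleBuilders.
Variables (A : pzRingType) (S : aring A).

Section Right.
Variables (M : rmodType A) (act : M -> S -> M).
Hypothesis actB : balanced act.
Hypothesis actZ : forall m s a, act m (s :* a) = act m s :* a.
Hypothesis actA : forall m s t, act (act m s) t = act m (s ∗ t).

Fact srmod_build_Z (x : M ⊗[A] S) a : tlift act (x :* a) = tlift act x :* a.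
Proof.
elim/tensor_ind: x => [m s|x y xP yP].
  by rewrite tensZr !(tliftE actB) actZ.
by rewrite rscaleDl !(tliftD actB) xP yP rscaleDl.
Qed.

Fact srmod_build_A m s t :
  tlift act (tlift act (m ⊗ s) ⊗ t) = tlift act (m ⊗ (s ∗ t)).
Proof. by rewrite !(tliftE actB). Qed.

Definition srmod_build : srmod S :=
  @SRMod A S M (RHom (tliftD actB) srmod_build_Z) srmod_build_A.

Lemma srmod_buildE (m : srmod_build) s : m ◃ s = act m s.
Proof. exact: tliftE. Qed.
End Right.

Section Left.
Variables (M : lmodType A) (act : S -> M -> M).
Hypothesis actB : balanced act.
Hypothesis actZ : forall a s m, act (a *: s) m = a *: act s m.
Hypothesis actA : forall s t m, act s (act t m) = act (s ∗ t) m.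

Fact slmod_build_linear : linear (tlift act).
Proof.
move=> a x y; rewrite (tliftD actB); congr (_ + _).
elim/tensor_ind: x => [s m|{}x z xP zP].
  by rewrite tensZl !(tliftE actB) actZ.
by rewrite scalerDr !(tliftD actB) xP zP scalerDr.
Qed.

Fact slmod_build_A s t m :
  tlift act (s ⊗ tlift act (t ⊗ m)) = tlift act ((s ∗ t) ⊗ m).
Proof. by rewrite !(tliftE actB). Qed.

Definition slmod_build : slmod S :=
  @SLMod A S M
    (HB.pack (tlift act) (GRing.isLinear.Build A _ _ *:%R (tlift act)
       slmod_build_linear)) slmod_build_A.

Lemma slmod_buildE s (m : slmod_build) : s ▹ m = act s m.
Proof. exact: tliftE. Qed.
End Left.

End ModuleBuilders.

Section ActTheory.
Variables (A : pzRingType) (S : aring A).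

Lemma ract_balanced (M : srmod S) : balanced (fun (m : M) (s : S) => m ◃ s).
Proof. by split=> *; rewrite ?tensDl ?tensDr ?rhomD // tensZ. Qed.

Lemma lact_balanced (M : slmod S) : balanced (fun (s : S) (m : M) => s ▹ m).
Proof. by split=> *; rewrite ?tensDl ?tensDr ?linearD // tensZ. Qed.

Lemma ract_Z (M : srmod S) (m : M) (s : S) a : m ◃ (s :* a) = (m ◃ s) :* a.
Proof. by rewrite -tensZr rhomZ. Qed.

Lemma lact_Z (M : slmod S) a (s : S) (m : M) : (a *: s) ▹ m = a *: (s ▹ m).
Proof. by rewrite -tensZl linearZ. Qed.

Lemma amul_balanced : balanced (@amul A S).
Proof.
by split=> *; rewrite /amul ?tensDl ?tensDr ?bihomD // tensZ.
Qed.

Lemma amulZr (s t : S) a : s ∗ (t :* a) = (s ∗ t) :* a.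
Proof. by rewrite /amul -tensZr bihomZr. Qed.

Lemma amulZl a (s t : S) : (a *: s) ∗ t = a *: (s ∗ t).
Proof. by rewrite /amul -tensZl bihomZl. Qed.

Lemma amulA (s t u : S) : (s ∗ t) ∗ u = s ∗ (t ∗ u).
Proof. exact: aring_mulA. Qed.

Definition srmod_self : srmod S :=
  srmod_build amul_balanced amulZr amulA.

Definition slmod_self : slmod S :=
  slmod_build amul_balanced amulZl (fun s t u => esym (amulA s t u)).

Section ProdPow.
Variables (M N : srmod S) (P Q : slmod S) (I : finType).

Definition srmod_prod_act (x : M * N) (s : S) : M * N := (x.1 ◃ s, x.2 ◃ s).

Fact srmod_prod_balanced : balanced srmod_prod_act.
Proof.
have [MDl MDr MZ] := ract_balanced M; have [NDl NDr NZ] := ract_balanced N.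
split=> [x y s|x s t|x a s]; apply/pair_equal_spec.
- by split; [exact: MDl | exact: NDl].
- by split; [exact: MDr | exact: NDr].
- by split; [exact: MZ | exact: NZ].
Qed.

Fact srmod_prod_Z x s a : srmod_prod_act x (s :* a) = srmod_prod_act x s :* a.
Proof. by apply/pair_equal_spec; rewrite !ract_Z. Qed.

Fact srmod_prod_A x s t :
  srmod_prod_act (srmod_prod_act x s) t = srmod_prod_act x (s ∗ t).
Proof. by apply/pair_equal_spec; rewrite !sractA. Qed.

Definition srmod_prod : srmod S :=
  srmod_build srmod_prod_balanced srmod_prod_Z srmod_prod_A.

Definition slmod_prod_act (s : S) (x : P * Q) : P * Q := (s ▹ x.1, s ▹ x.2).

Fact slmod_prod_balanced : balanced slmod_prod_act.
Proof.
have [MDl MDr MZ] := lact_balanced P; have [NDl NDr NZ] := lact_balanced Q.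
split=> [x y s|x s t|x a s]; apply/pair_equal_spec.
- by split; [exact: MDl | exact: NDl].
- by split; [exact: MDr | exact: NDr].
- by split; [exact: MZ | exact: NZ].
Qed.

Fact slmod_prod_Z a s x : slmod_prod_act (a *: s) x = a *: slmod_prod_act s x.
Proof. by apply/pair_equal_spec; rewrite !lact_Z. Qed.

Fact slmod_prod_A s t x :
  slmod_prod_act s (slmod_prod_act t x) = slmod_prod_act (s ∗ t) x.
Proof. by apply/pair_equal_spec; rewrite !slactA. Qed.

Definition slmod_prod : slmod S :=
  slmod_build slmod_prod_balanced slmod_prod_Z slmod_prod_A.

Definition srmod_pow_act (x : {ffun I -> M}) (s : S) : {ffun I -> M} :=
  [ffun i => x i ◃ s].

Fact srmod_pow_balanced : balanced srmod_pow_act.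
Proof.
have [MDl MDr MZ] := ract_balanced M.
split=> [x y s|x s t|x a s]; apply/ffunP=> i; rewrite !ffunE.
- exact: MDl.
- exact: MDr.
- exact: MZ.
Qed.

Fact srmod_pow_Z x s a : srmod_pow_act x (s :* a) = srmod_pow_act x s :* a.
Proof. by apply/ffunP=> i; rewrite !ffunE ract_Z. Qed.

Fact srmod_pow_A x s t :
  srmod_pow_act (srmod_pow_act x s) t = srmod_pow_act x (s ∗ t).
Proof. by apply/ffunP=> i; rewrite !ffunE sractA. Qed.

Definition srmod_pow : srmod S :=
  srmod_build srmod_pow_balanced srmod_pow_Z srmod_pow_A.

Definition slmod_pow_act (s : S) (x : {ffun I -> P}) : {ffun I -> P} :=
  [ffun i => s ▹ x i].

Fact slmod_pow_balanced : balanced slmod_pow_act.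
Proof.
have [MDl MDr MZ] := lact_balanced P.
split=> [x y s|x s t|x a s]; apply/ffunP=> i; rewrite !ffunE.
- exact: MDl.
- exact: MDr.
- exact: MZ.
Qed.

Fact slmod_pow_Z a s x : slmod_pow_act (a *: s) x = a *: slmod_pow_act s x.
Proof. by apply/ffunP=> i; rewrite !ffunE lact_Z. Qed.

Fact slmod_pow_A s t x :
  slmod_pow_act s (slmod_pow_act t x) = slmod_pow_act (s ∗ t) x.
Proof. by apply/ffunP=> i; rewrite !ffunE slactA. Qed.

Definition slmod_pow : slmod S :=
  slmod_build slmod_pow_balanced slmod_pow_Z slmod_pow_A.

End ProdPow.

Definition sr_summand (M P : srmod S) : Prop :=
  exists (N : srmod S) (f : srhom (srmod_prod M N) P), bijective f.

Definition sl_summand (M P : slmod S) : Prop :=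
  exists (N : slmod S) (f : slhom (slmod_prod M N) P), bijective f.

End ActTheory.

(* M ⊗_S N for an A-ring S, as the cokernel of
   M ⊗_A S ⊗_A N -> M ⊗_A N, m ⊗ s ⊗ n |-> m s ⊗ n - m ⊗ s n. *)
Section TensorOverARing.
Variables (A : pzRingType) (S : aring A) (M : srmod S) (N : slmod S).

Inductive stensor_rel : M ⊗[A] N -> Prop :=
| STensor (m : M) (s : S) (n : N) :
    stensor_rel ((m ◃ s) ⊗ n - m ⊗ (s ▹ n)).

Definition stensor : Type := zquot stensor_rel.
HB.instance Definition _ := GRing.Zmodule.on stensor.

(* The map induced on the cokernel by an additive map f killing the relations;
   it does not depend on representatives, see [sliftE]. *)
Definition slift (G : zmodType) (f : M ⊗[A] N -> G) (t : stensor) : G :=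
  f (zrepr t).

Lemma sliftE (G : zmodType) (f : {additive M ⊗[A] N -> G}) :
  (forall m s n, f ((m ◃ s) ⊗ n) = f (m ⊗ (s ▹ n))) ->
  forall t, slift f (zpi stensor_rel t) = f t.
Proof.
move=> fS t; apply: zpi_kernel => _ [m s n].
by rewrite raddfB fS subrr.
Qed.

End TensorOverARing.

Definition firm_srmod (A : pzRingType) (S : aring A) (M : srmod S) : Prop :=
  bijective (@slift A S M (slmod_self S) M (sract M)).

(* Generators in the categorical sense: the functor Hom(G, -) is faithful. *)

Definition lgenerator (R : pzRingType) (G : lmodType R) : Prop :=
  forall (M N : lmodType R) (f h : {linear M -> N}),
    (forall k : {linear G -> M}, f \o k =1 h \o k) -> f =1 h.

Definition rgenerator (R : pzRingType) (G : rmodType R) : Prop :=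
  forall (M N : rmodType R) (f h : rhom M N),
    (forall k : rhom G M, f \o k =1 h \o k) -> f =1 h.

(* The product of S has an (S, S)-bimodule section; on S ⊗_A S the two actions
   are s (x ⊗ y) = (s x) ⊗ y and (x ⊗ y) t = x ⊗ (y t). *)
Definition aring_separable (A : pzRingType) (S : aring A) : Prop :=
  exists sigma : bihom S (S ⊗[A] S),
    [/\ forall s, aring_mul S (sigma s) = s,
        forall s t : S, sigma (s ∗ t) = \Sum_(x, y <- sigma t) ((s ∗ x) ⊗ y)
      & forall s t : S, sigma (s ∗ t) = \Sum_(x, y <- sigma s) (x ⊗ (y ∗ t))].

Section Cointegral.
Variables (A : pzRingType) (C : coring A) (gam : cointegral C).

Local Notation Delta := (comul C).
Local Notation gm c c' := (gam (c ⊗ c') : A).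

Lemma gamDl c c' d : gm (c + c') d = gm c d + gm c' d.
Proof. by rewrite tensDl bihomD. Qed.
Lemma gamBl c c' d : gm (c - c') d = gm c d - gm c' d.
Proof.
have hD x y : gm (x + y) d = gm x d + gm y d by exact: gamDl.
by rewrite gamDl (additive_int hD).
Qed.
Lemma gamDr c d d' : gm c (d + d') = gm c d + gm c d'.
Proof. by rewrite tensDr bihomD. Qed.
Lemma gamZ c a d : gm (c :* a) d = gm c (a *: d).
Proof. by rewrite tensZ. Qed.
Lemma gamZl a c d : gm (a *: c) d = a * gm c d.
Proof. by rewrite -tensZl bihomZl. Qed.
Lemma gamZr c d a : gm c (d :* a) = gm c d * a.
Proof. by rewrite -tensZr bihomZr. Qed.

Fact cmull_balanced c : balanced (fun x y : C => gm c x *: y).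
Proof.
split=> *; first by rewrite gamDr scalerDl.
  by rewrite scalerDr.
by rewrite gamZr scalerA.
Qed.

Fact cmulr_balanced c' : balanced (fun x y : C => x :* gm y c').
Proof.
split=> *; first by rewrite rscaleDl.
  by rewrite gamDl rscaleDr.
by rewrite gamZl rscaleA.
Qed.

Definition cmul (c c' : C) : C := \Sum_(x, y <- Delta c') (gm c x *: y).

Lemma cmulE c c' : cmul c c' = \Sum_(x, y <- Delta c) (x :* gm y c').
Proof. exact: cointegral_colin. Qed.

Fact cmul_balanced : balanced cmul.
Proof.
split=> [c c' d|c d d'|c a d].
- rewrite /cmul -tlift_add; apply: tlift_ext => x y.
  by rewrite gamDl scalerDl.
- by rewrite /cmul bihomD (tliftD (cmull_balanced c)).
- rewrite /cmul bihomZl; elim/tensor_ind: (Delta d) => [x y|s t sP tP].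
    by rewrite tensZl !(tliftE (cmull_balanced _)) gamZ.
  by rewrite scalerDr !(tliftD (cmull_balanced _)) sP tP.
Qed.

Fact cmulZr c d a : cmul c (d :* a) = cmul c d :* a.
Proof.
rewrite /cmul bihomZr; elim/tensor_ind: (Delta d) => [x y|s t sP tP].
  by rewrite tensZr !(tliftE (cmull_balanced _)) bscaleA.
by rewrite rscaleDl !(tliftD (cmull_balanced _)) sP tP rscaleDl.
Qed.

Fact cmulZl a c d : cmul (a *: c) d = a *: cmul c d.
Proof.
rewrite /cmul tlift_comp => [|x y]; last by rewrite scalerDr.
by apply: tlift_ext => x y; rewrite gamZl scalerA.
Qed.

Fact cring_mulZl a x : tlift cmul (a *: x) = a *: tlift cmul x.
Proof.
elim/tensor_ind: x => [m s|x y xP yP].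
  by rewrite tensZl !(tliftE cmul_balanced) cmulZl.
by rewrite scalerDr !(tliftD cmul_balanced) xP yP scalerDr.
Qed.

Fact cring_mulZr x a : tlift cmul (x :* a) = tlift cmul x :* a.
Proof.
elim/tensor_ind: x => [m s|x y xP yP].
  by rewrite tensZr !(tliftE cmul_balanced) cmulZr.
by rewrite rscaleDl !(tliftD cmul_balanced) xP yP rscaleDl.
Qed.

Lemma gam_cmul c c' c'' : gm (cmul c c') c'' = gm c (cmul c' c'').
Proof.
rewrite [cmul c' c'']cmulE {1}/cmul.
rewrite (@tlift_comp _ _ _ _ A (fun x : C => gm x c'')); last first.
  by move=> *; rewrite gamDl.
rewrite (@tlift_comp _ _ _ _ A (fun x : C => gm c x)); last exact: gamDr.
by apply: tlift_ext => x y; rewrite gamZl gamZr.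
Qed.

(* Δ(c c') = sum c c'_1 ⊗ c'_2. *)
Lemma comul_cmul c c' : Delta (cmul c c') = \Sum_(x, y <- Delta c') (cmul c x ⊗ y).
Proof.
rewrite {1}/cmul tlift_comp; last exact: bihomD.
have fB : balanced (fun (x : C) (y : C ⊗[A] C) => gm c x *: y).
  split=> *; first by rewrite gamDr scalerDl.
    by rewrite scalerDr.
  by rewrite gamZr scalerA.
transitivity (tlift (fun (x : C) (y : C ⊗[A] C) => gm c x *: y)
   (\Sum_(x, y <- Delta c') (x ⊗ Delta y))).
  rewrite tlift_comp; last exact: tliftD.
  by apply: tlift_ext => x y; rewrite tliftE // bihomZl.
rewrite -coassoc tlift_comp; last exact: tliftD.
apply: tlift_ext => x y; rewrite tlift_comp; last exact: tliftD.
rewrite /cmul (@tlift_comp _ _ _ _ _ (fun x : C => x ⊗ y)); last first.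
  by move=> *; rewrite tensDl.
by apply: tlift_ext => u v; rewrite tliftE // tensZl.
Qed.

Fact cmulA c c' c'' : cmul (cmul c c') c'' = cmul c (cmul c' c'').
Proof.
rewrite [RHS]/cmul comul_cmul tlift_comp; last first.
  exact: (tliftD (cmull_balanced c)).
rewrite [LHS]/cmul; apply: tlift_ext => x y.
by rewrite (tliftE (cmull_balanced c)) -gam_cmul.
Qed.

Fact cring_mulA s t u :
  tlift cmul (tlift cmul (s ⊗ t) ⊗ u) = tlift cmul (s ⊗ tlift cmul (t ⊗ u)).
Proof. by rewrite !(tliftE cmul_balanced) cmulA. Qed.

Fact cmulr_lift_Zl c' a (w : C ⊗[A] C) :
  tlift (fun x y : C => x :* gm y c') (a *: w)
  = a *: tlift (fun x y : C => x :* gm y c') w.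
Proof.
have kB := cmulr_balanced c'.
elim/tensor_ind: w => [x y|s t sP tP].
  by rewrite tensZl !(tliftE kB) bscaleA.
by rewrite scalerDr !(tliftD kB) sP tP scalerDr.
Qed.

(* Δ(c c') = sum c_1 ⊗ c_2 c'. *)
Lemma comul_cmul_r c c' :
  Delta (cmul c c') = \Sum_(x, y <- Delta c) (x ⊗ cmul y c').
Proof.
rewrite {1}cmulE tlift_comp; last exact: bihomD.
pose k := fun v y : C => v :* gm y c'.
have kB : balanced k by exact: cmulr_balanced.
have fB : balanced (fun (x : C) (w : C ⊗[A] C) => x ⊗ tlift k w).
  split=> *; first by rewrite tensDl.
    by rewrite (tliftD kB) tensDr.
  by rewrite tensZ cmulr_lift_Zl.
transitivity (tlift (fun (x : C) (w : C ⊗[A] C) => x ⊗ tlift k w)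
   (\Sum_(x, y <- Delta c) (x ⊗ Delta y))); last first.
  rewrite tlift_comp; last exact: tliftD.
  by apply: tlift_ext => x y; rewrite tliftE // cmulE.
rewrite -coassoc tlift_comp; last exact: tliftD.
apply: tlift_ext => x y; rewrite tlift_comp; last exact: tliftD.
rewrite bihomZr -[in LHS](tlift_tens (Delta x)).
rewrite (@tlift_comp _ _ _ _ _ (fun w : C ⊗[A] C => w :* gm y c')); last first.
  by move=> *; rewrite rscaleDl.
by apply: tlift_ext => u v; rewrite tliftE // tliftE // tensZr.
Qed.

Definition cring : aring A :=
  @ARing A C (BiHom (tliftD cmul_balanced) cring_mulZl cring_mulZr) cring_mulA.

Lemma cring_amul (c c' : C) : (c : cring) ∗ c' = cmul c c'.
Proof. exact: tliftE cmul_balanced _ _. Qed.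

Fact cmul_comul c : \Sum_(x, y <- Delta c) cmul x y = c.
Proof.
have gB : balanced (fun (x : C) (w : C ⊗[A] C) =>
                      \Sum_(y, z <- w) (gm x y *: z)).
  split=> [x x' w|x w w'|x a w].
  - rewrite -tlift_add; apply: tlift_ext => y z.
    by rewrite gamDl scalerDl.
  - exact: (tliftD (cmull_balanced x)).
  - elim/tensor_ind: w => [y z|s t sP tP].
      by rewrite tensZl !(tliftE (cmull_balanced _)) gamZ.
    by rewrite scalerDr !(tliftD (cmull_balanced _)) sP tP.
rewrite -[RHS]counitl.
transitivity (tlift (fun (x : C) (w : C ⊗[A] C) => \Sum_(y, z <- w) (gm x y *: z))
   (\Sum_(x, y <- Delta c) (x ⊗ Delta y))).
  rewrite tlift_comp; last exact: tliftD.
  by apply: tlift_ext => x y; rewrite (tliftE gB).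
rewrite -coassoc tlift_comp; last exact: tliftD.
apply: tlift_ext => x y; rewrite tlift_comp; last exact: tliftD.
rewrite -(cointegral_norm gam) -[in RHS](tlift_tens (Delta x)).
rewrite (@tlift_comp _ _ _ _ _ (fun w : C ⊗[A] C => (gam w : A) *: y)); last first.
  by move=> *; rewrite bihomD scalerDl.
by apply: tlift_ext => u v; rewrite (tliftE gB) (tliftE (cmull_balanced _)).
Qed.

Lemma cring_separable : aring_separable cring.
Proof.
exists (comul C); split=> [c|c d|c d].
- exact: cmul_comul.
- rewrite cring_amul comul_cmul.
  by apply: tlift_ext => x y; rewrite cring_amul.
- rewrite cring_amul comul_cmul_r.
  by apply: tlift_ext => x y; rewrite cring_amul.
Qed.

End Cointegral.

(* A as a (B, A)-bimodule, for B = [Bsub gam g] below; gam and g are phantom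
   arguments from which the scalar ring B is inferred. *)
Definition AB (A : pzRingType) (C : coring A) (gam : cointegral C)
  (g : grouplike C) : Type := A.

Section Subobjects.
Variables (A : pzRingType) (C : coring A) (gam : cointegral C) (g : grouplike C).

Local Notation gm c c' := (gam (c ⊗ c') : A).

Local Notation g0 := (grouplike_elt g).

Definition Bset : {pred A} := fun b =>
  `[< forall c : C, gm (g0 :* b) c = b * gm g0 c >].

Lemma BsetP b :
  reflect (forall c : C, gm (g0 :* b) c = b * gm g0 c) (b \in Bset).
Proof. exact: asboolP. Qed.

Fact Bset_subring : subring_closed Bset.
Proof.
split=> [|x y /BsetP Px /BsetP Py|x y /BsetP Px /BsetP Py];
  apply/BsetP=> c.
- by rewrite rscaler1 mul1r.
- by rewrite rscaleBr gamBl Px Py mulrBl.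
- by rewrite -rscaleA gamZ Px -gamZ Py mulrA.
Qed.
HB.instance Definition _ := GRing.isSubringClosed.Build A Bset Bset_subring.

Definition Bsub : Type := {b : A | b \in Bset}.
HB.instance Definition _ := [isSub of Bsub for @sval A (fun b => b \in Bset)].
HB.instance Definition _ := [Choice of Bsub by <:].
HB.instance Definition _ :=
  GRing.SubChoice_isSubPzRing.Build A Bset Bsub Bset_subring.

Definition Qset : {pred C} := fun q =>
  `[< forall c : C, (q : cring gam) ∗ c = q :* gm g0 c >].

Lemma QsetP q :
  reflect (forall c : C, (q : cring gam) ∗ c = q :* gm g0 c) (q \in Qset).
Proof. exact: asboolP. Qed.

Fact Qset_submod : submod_closed Qset.
Proof.
split=> [|a x y /QsetP Px /QsetP Py]; apply/QsetP=> c.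
  by rewrite /amul tens0l rscale0l (additive_int (bihomD _)).
rewrite /amul tensDl bihomD -/(amul _ _) -/(amul _ _) amulZl Px Py.
by rewrite rscaleDl bscaleA.
Qed.

Definition Qsub : Type := {q : C | q \in Qset}.
HB.instance Definition _ := [isSub of Qsub for @sval C (fun q => q \in Qset)].
HB.instance Definition _ := [Choice of Qsub by <:].
HB.instance Definition _ :=
  GRing.SubChoice_isSubLmodule.Build A C Qset Qsub
    (GRing.submod_closed_semi Qset_submod).

Fact Qset_rscale (q : Qsub) (b : Bsub) : (val q : C) :* (val b : A) \in Qset.
Proof.
apply/QsetP=> c; rewrite /amul tensZ -/(amul _ _).
have /QsetP -> := valP q; have /BsetP := valP b => bP.
by rewrite -gamZ bP rscaleA.
Qed.

Definition Q_rscale (q : Qsub) (b : Bsub) : Qsub :=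
  exist _ ((val q : C) :* (val b : A)) (Qset_rscale q b).

Fact Q_rscaleA x a b : Q_rscale (Q_rscale x a) b = Q_rscale x (a * b).
Proof. by apply: val_inj; rewrite /= rscaleA. Qed.
Fact Q_rscaler1 x : Q_rscale x 1 = x.
Proof. by apply: val_inj; rewrite /= rscaler1. Qed.
Fact Q_rscaleDl x y a : Q_rscale (x + y) a = Q_rscale x a + Q_rscale y a.
Proof. by apply: val_inj; rewrite /= rscaleDl. Qed.
Fact Q_rscaleDr x a b : Q_rscale x (a + b) = Q_rscale x a + Q_rscale x b.
Proof. by apply: val_inj; rewrite /= rscaleDr. Qed.
HB.instance Definition _ := Zmodule_isRmodule.Build Bsub Qsub
  Q_rscaleA Q_rscaler1 Q_rscaleDl Q_rscaleDr.

Fact Qset_ideal (c : cring gam) (q : Qsub) : c ∗ (val q : cring gam) \in Qset.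
Proof.
by apply/QsetP=> d; rewrite amulA; have /QsetP -> := valP q; rewrite amulZr.
Qed.

Definition Q_act (c : cring gam) (q : Qsub) : Qsub :=
  exist _ (c ∗ (val q : cring gam)) (Qset_ideal c q).

Fact Q_act_balanced : balanced (M := cring gam) Q_act.
Proof.
have [bDl bDr bZ] := amul_balanced (cring gam).
by split=> *; apply: val_inj; rewrite /= ?bDl ?bDr ?bZ.
Qed.

Fact Q_actZ a c q : Q_act (a *: c) q = a *: Q_act c q.
Proof. by apply: val_inj; rewrite /= amulZl. Qed.

Fact Q_actA c d q : Q_act c (Q_act d q) = Q_act (c ∗ d) q.
Proof. by apply: val_inj; rewrite /= amulA. Qed.

Definition Q_slmod : slmod (cring gam) := slmod_build Q_act_balanced Q_actZ Q_actA.

Definition A_act (a : A^o) (c : cring gam) : A^o := gm (g0 :* (a : A)) c.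

Fact A_act_balanced : balanced A_act.
Proof.
split=> *; rewrite /A_act.
- by rewrite rscaleDr gamDl.
- by rewrite gamDr.
- by rewrite -gamZ rscaleA.
Qed.

Fact A_actZ a c b : A_act a (c :* b) = A_act a c :* b.
Proof. exact: (gamZr gam (g0 :* (a : A)) (c : C) b). Qed.

Lemma grouplike_cmul (a : A) (c : C) : cmul gam (g0 :* a) c = g0 :* gm (g0 :* a) c.
Proof.
by rewrite cmulE bihomZr grouplike_comul tensZr (tliftE (cmulr_balanced _ _)).
Qed.

Fact A_actA a c d : A_act (A_act a c) d = A_act a (c ∗ d).
Proof. by rewrite /A_act -grouplike_cmul gam_cmul cring_amul. Qed.

Definition A_srmod : srmod (cring gam) := srmod_build A_act_balanced A_actZ A_actA.

Local Notation AB := (AB gam g).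
HB.instance Definition _ := GRing.Zmodule.copy AB A.

Definition AB_lscale (b : Bsub) (a : AB) : AB := (val b : A) * (a : A).
Fact AB_lscaleA a b v : AB_lscale a (AB_lscale b v) = AB_lscale (a * b) v.
Proof. exact: mulrA. Qed.
Fact AB_lscale1 : left_id 1 AB_lscale.
Proof. exact: mul1r. Qed.
Fact AB_lscaleDr : right_distributive AB_lscale +%R.
Proof. by move=> a x y; apply: mulrDr. Qed.
Fact AB_lscaleDl v : {morph AB_lscale^~ v : a b / a + b}.
Proof. by move=> a b; apply: mulrDl. Qed.
HB.instance Definition _ := GRing.Zmodule_isLmodule.Build Bsub AB
  AB_lscaleA AB_lscale1 AB_lscaleDr AB_lscaleDl.

HB.instance Definition _ := Zmodule_isRmodule.Build A AB
  (fun x a b => esym (mulrA (x : A) a b)) (@mulr1 A)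
  (fun x y a => mulrDl (x : A) y a) (fun x a b => mulrDr (x : A) a b).
HB.instance Definition _ := isBimodule.Build Bsub A AB
  (fun a x b => esym (mulrA (val a : A) (x : A) b)).

Section Induced.
Variable N : rmodType Bsub.

Definition tensA_act (t : N ⊗[Bsub] AB) (c : cring gam) : N ⊗[Bsub] AB :=
  tlift (fun (n : N) (a : AB) => n ⊗ (gm (g0 :* (a : A)) c : AB)) t.

Fact tensA_act_fun_balanced c :
  balanced (fun (n : N) (a : AB) => n ⊗ (gm (g0 :* (a : A)) c : AB)).
Proof.
split=> [n n' a|n a a'|n b a]; first by rewrite tensDl.
  by rewrite rscaleDr gamDl tensDr.
rewrite tensZ; congr (_ ⊗ _).
have /BsetP bP := valP b.
transitivity (gm (g0 :* val b) (a *: (c : C)) : A); last first.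
  by rewrite -gamZ rscaleA.
by rewrite bP -gamZ.
Qed.

Lemma tensA_actE n (a : AB) c :
  tensA_act (n ⊗ a) c = n ⊗ (gm (g0 :* (a : A)) c : AB).
Proof. exact: (tliftE (tensA_act_fun_balanced c)). Qed.

Fact tensA_actDl x y c : tensA_act (x + y) c = tensA_act x c + tensA_act y c.
Proof. exact: (tliftD (tensA_act_fun_balanced c)). Qed.

Fact tensA_act_balanced : balanced tensA_act.
Proof.
split=> [x y c|t c d|t a c]; first exact: tensA_actDl.
  elim/tensor_ind: t => [n a|x y xP yP].
    by rewrite !tensA_actE gamDr tensDr.
  by rewrite !tensA_actDl xP yP addrACA.
elim/tensor_ind: t => [n b|x y xP yP].
  by rewrite tensZr !tensA_actE -gamZ rscaleA.
by rewrite rscaleDl !tensA_actDl xP yP.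
Qed.

Fact tensA_actZ t c a : tensA_act t (c :* a) = tensA_act t c :* a.
Proof.
elim/tensor_ind: t => [n b|x y xP yP].
  by rewrite !tensA_actE tensZr gamZr.
by rewrite !tensA_actDl rscaleDl xP yP.
Qed.

Fact tensA_actA t c d : tensA_act (tensA_act t c) d = tensA_act t (c ∗ d).
Proof.
elim/tensor_ind: t => [n b|x y xP yP].
  by rewrite !tensA_actE -grouplike_cmul gam_cmul cring_amul.
by rewrite !tensA_actDl xP yP.
Qed.

Definition tensA : srmod (cring gam) :=
  srmod_build tensA_act_balanced tensA_actZ tensA_actA.

End Induced.

Section InducedMap.
Variables (N N' : rmodType Bsub) (f : rhom N N').

Fact tensA_map_balanced : balanced (fun (n : N) (a : AB) => f n ⊗ a).
Proof. by split=> *; rewrite ?rhomD ?rhomZ ?tensDl ?tensDr ?tensZ. Qed.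

Let F : tensA N -> tensA N' := tlift (fun (n : N) (a : AB) => f n ⊗ a).

Fact tensA_mapD x y : F (x + y) = F x + F y.
Proof. exact: (tliftD tensA_map_balanced). Qed.

Fact tensA_mapZ x a : F (x :* a) = F x :* a.
Proof.
elim/tensor_ind: x => [n b|x y xP yP].
  by rewrite tensZr /F !(tliftE tensA_map_balanced) tensZr.
by rewrite rscaleDl !tensA_mapD xP yP rscaleDl.
Qed.

Fact tensA_mapM (x : tensA N) (c : cring gam) : F (x ◃ c) = F x ◃ c.
Proof.
rewrite !srmod_buildE; elim/tensor_ind: x => [n b|x y xP yP].
  by rewrite tensA_actE /F !(tliftE tensA_map_balanced) tensA_actE.
by rewrite tensA_mapD !tensA_actDl tensA_mapD xP yP.
Qed.

Definition tensA_map : srhom (tensA N) (tensA N') :=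
  @SRHom A (cring gam) (tensA N) (tensA N') (RHom tensA_mapD tensA_mapZ)
    tensA_mapM.

End InducedMap.

(* The right B-module of m in M with m c = m gam(g ⊗ c) for all c. *)
Section Invariants.
Variable M : srmod (cring gam).

Definition invset : {pred M} := fun m =>
  `[< forall c : cring gam, m ◃ c = m :* gm g0 c >].

Lemma invsetP m :
  reflect (forall c : cring gam, m ◃ c = m :* gm g0 c) (m \in invset).
Proof. exact: asboolP. Qed.

Fact invset_zmod : zmod_closed invset.
Proof.
split=> [|x y /invsetP Px /invsetP Py]; apply/invsetP=> c.
  by rewrite tens0l (additive_int (rhomD _)) rscale0l.
rewrite tensDl rhomD tensNl (additive_int (rhomD (sract M))) Px Py.
by rewrite rscaleBl.
Qed.

Definition invariants : Type := {m : M | m \in invset}.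
HB.instance Definition _ := [isSub of invariants for @sval M (fun m => m \in invset)].
HB.instance Definition _ := [Choice of invariants by <:].
HB.instance Definition _ := GRing.SubChoice_isSubZmodule.Build M invset invariants invset_zmod.

Fact invset_rscale (m : invariants) (b : Bsub) : (val m : M) :* (val b : A) \in invset.
Proof.
apply/invsetP=> c; rewrite tensZ.
have /invsetP -> := valP m; have /BsetP bP := valP b.
by rewrite -gamZ bP rscaleA.
Qed.

Definition invariants_rscale (m : invariants) (b : Bsub) : invariants :=
  exist _ ((val m : M) :* (val b : A)) (invset_rscale m b).

Fact invariants_rscaleA x a b : invariants_rscale (invariants_rscale x a) b = invariants_rscale x (a * b).
Proof. by apply: val_inj; rewrite /= rscaleA. Qed.
Fact invariants_rscaler1 x : invariants_rscale x 1 = x.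
Proof. by apply: val_inj; rewrite /= rscaler1. Qed.
Fact invariants_rscaleDl x y a : invariants_rscale (x + y) a = invariants_rscale x a + invariants_rscale y a.
Proof. by apply: val_inj; rewrite /= rscaleDl. Qed.
Fact invariants_rscaleDr x a b : invariants_rscale x (a + b) = invariants_rscale x a + invariants_rscale x b.
Proof. by apply: val_inj; rewrite /= rscaleDr. Qed.
HB.instance Definition _ := Zmodule_isRmodule.Build Bsub invariants
  invariants_rscaleA invariants_rscaler1 invariants_rscaleDl invariants_rscaleDr.

End Invariants.

Section InvariantsMap.
Variables (M M' : srmod (cring gam)) (f : srhom M M').

Fact invariants_map_in (m : invariants M) : f (val m) \in invset (M := M').
Proof.
by apply/invsetP=> c; rewrite -srhomM -rhomZ; have /invsetP -> := valP m.
Qed.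

Definition invariants_map_fun (m : invariants M) : invariants M' := exist _ (f (val m)) (invariants_map_in m).

Fact invariants_mapD x y : invariants_map_fun (x + y) = invariants_map_fun x + invariants_map_fun y.
Proof. by apply: val_inj; rewrite /= rhomD. Qed.

Fact invariants_mapZ x b : invariants_map_fun (x :* b) = invariants_map_fun x :* b.
Proof. by apply: val_inj; rewrite /= rhomZ. Qed.

Definition invariants_map : rhom (invariants M) (invariants M') := RHom invariants_mapD invariants_mapZ.

End InvariantsMap.

Section Unit.
Variable N : rmodType Bsub.

Fact tensA_unit_in (n : N) : (n ⊗ (1 : AB) : tensA N) \in invset (M := tensA N).
Proof.
apply/invsetP=> c; rewrite srmod_buildE tensA_actE tensZr rscaler1.
by congr (_ ⊗ _); rewrite -[LHS]mul1r.
Qed.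

Definition tensA_unit_fun (n : N) : invariants (tensA N) := exist _ (n ⊗ (1 : AB)) (tensA_unit_in n).

Fact tensA_unitD x y : tensA_unit_fun (x + y) = tensA_unit_fun x + tensA_unit_fun y.
Proof. by apply: val_inj; rewrite /= tensDl. Qed.

Fact tensA_unitZ x b : tensA_unit_fun (x :* b) = tensA_unit_fun x :* b.
Proof.
apply: val_inj; rewrite /= tensZ tensZr; congr (_ ⊗ _).
by rewrite -[RHS]/(1 * val b) mul1r -[LHS]/(val b * 1) mulr1.
Qed.

Definition tensA_unit : rhom N (invariants (tensA N)) := RHom tensA_unitD tensA_unitZ.

End Unit.

End Subobjects.

(* Main.v *)
Require Import Defs.
From HB Require Import structures.
From mathcomp Require Import all_boot all_algebra.

(* Since γ(g ⊗ g) = ε(g) = 1, the map a |-> γ(ga ⊗ g) is a left B-linear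
   retraction of A onto B, and q |-> γ(g ⊗ q) is a right B-linear map Q -> B
   sending g to 1; this gives (4). Because (ga)c = g γ(ga ⊗ c), the right
   C-linear map a |-> ga embeds A in C, with retraction c |-> γ(g ⊗ c), while
   c |-> cg retracts C onto Q; this gives (3) with n = 1. An invariant
   t = sum_i n_i ⊗ a_i of N ⊗_B A satisfies t = t γ(g ⊗ g) = t g, and
   t g = (sum_i n_i γ(g a_i ⊗ g)) ⊗ 1, so the unit is invertible; the functor
   is then fully faithful by the adjunction. *)

Set Implicit Arguments.
Unset Strict Implicit.
Unset Printing Implicit Defensive.

Import GRing.Theory.
Local Open Scope ring_scope.

(** * Split monomorphisms and direct summands over an A-ring *)

Section ARingModules.
Variables (A : pzRingType) (S : aring A).

Section Right.
Variables (M P : srmod S) (i : srhom M P) (r : srhom P M).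

Definition rker : {pred P} := fun x => r x == 0.

Fact rker_zmod : zmod_closed rker.
Proof.
split=> [|x y /eqP rx /eqP ry]; apply/eqP; first exact: (additive_int (rhomD r)).1.
by rewrite rhomD (additive_int (rhomD r)) rx ry subr0.
Qed.

Definition rker_sub : Type := {x : P | x \in rker}.
HB.instance Definition _ := [isSub of rker_sub for @sval P (fun x => x \in rker)].
HB.instance Definition _ := [Choice of rker_sub by <:].
HB.instance Definition _ :=
  GRing.SubChoice_isSubZmodule.Build P rker rker_sub rker_zmod.

Fact rker_rscale_in (x : rker_sub) a : (val x : P) :* a \in rker.
Proof. by apply/eqP; rewrite rhomZ (eqP (valP x)) rscale0l. Qed.

Definition rker_rscale (x : rker_sub) (a : A) : rker_sub :=
  exist _ ((val x : P) :* a) (rker_rscale_in x a).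

Fact rker_rscaleA x a b : rker_rscale (rker_rscale x a) b = rker_rscale x (a * b).
Proof. by apply: val_inj; rewrite /= rscaleA. Qed.
Fact rker_rscaler1 x : rker_rscale x 1 = x.
Proof. by apply: val_inj; rewrite /= rscaler1. Qed.
Fact rker_rscaleDl x y a : rker_rscale (x + y) a = rker_rscale x a + rker_rscale y a.
Proof. by apply: val_inj; rewrite /= rscaleDl. Qed.
Fact rker_rscaleDr x a b : rker_rscale x (a + b) = rker_rscale x a + rker_rscale x b.
Proof. by apply: val_inj; rewrite /= rscaleDr. Qed.
HB.instance Definition _ := Zmodule_isRmodule.Build A rker_sub
  rker_rscaleA rker_rscaler1 rker_rscaleDl rker_rscaleDr.

Fact rker_act_in (x : rker_sub) (s : S) : (val x : P) ◃ s \in rker.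
Proof.
apply/eqP; rewrite srhomM (eqP (valP x)) tens0l.
exact: (additive_int (rhomD _)).1.
Qed.

Definition rker_act (x : rker_sub) (s : S) : rker_sub :=
  exist _ ((val x : P) ◃ s) (rker_act_in x s).

Fact rker_act_balanced : balanced rker_act.
Proof.
have [bDl bDr bZ] := ract_balanced P.
by split=> *; apply: val_inj; rewrite /= ?bDl ?bDr ?bZ.
Qed.

Fact rker_actZ x s a : rker_act x (s :* a) = rker_act x s :* a.
Proof. by apply: val_inj; rewrite /= ract_Z. Qed.

Fact rker_actA x s t : rker_act (rker_act x s) t = rker_act x (s ∗ t).
Proof. by apply: val_inj; rewrite /= sractA. Qed.

Definition rker_srmod : srmod S :=
  srmod_build rker_act_balanced rker_actZ rker_actA.

Definition rsplit_fun (x : srmod_prod M rker_srmod) : P := i x.1 + val x.2.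

Fact rsplitD x y : rsplit_fun (x + y) = rsplit_fun x + rsplit_fun y.
Proof. by rewrite /rsplit_fun rhomD addrACA. Qed.

Fact rsplitZ x a : rsplit_fun (x :* a) = rsplit_fun x :* a.
Proof. by rewrite /rsplit_fun rhomZ rscaleDl. Qed.

Fact rsplitM (x : srmod_prod M rker_srmod) (s : S) :
  rsplit_fun (x ◃ s) = rsplit_fun x ◃ s.
Proof.
have -> : x ◃ s = srmod_prod_act x s by exact: srmod_buildE.
rewrite /rsplit_fun tensDl rhomD /= srhomM; congr (_ + _).
by rewrite (tliftE rker_act_balanced).
Qed.

(** The complement is the kernel of the retraction: p = i (r p) + (p - i (r p)), and [r] kills the
    second term because r i = id. *)
Lemma split_sr_summand : cancel i r -> sr_summand M P.
Proof.
move=> iK; exists rker_srmod.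
exists (@SRHom A S (srmod_prod M rker_srmod) P (RHom rsplitD rsplitZ) rsplitM).
have rest p : p - i (r p) \in rker.
  by apply/eqP; rewrite rhomD (additive_int (rhomD r)) iK subrr.
exists (fun p => (r p, exist _ (p - i (r p)) (rest p))) => [[m [x xP]]|p].
  have rE : r (i m + x) = m by rewrite rhomD iK (eqP xP) addr0.
  congr pair; rewrite /= /rsplit_fun /= ?rE //.
  by apply: val_inj; rewrite /= /rsplit_fun /= rE addrC addKr.
by rewrite /= /rsplit_fun /= addrC subrK.
Qed.

End Right.

Section Left.
Variables (M P : slmod S) (i : slhom M P) (r : slhom P M).

Definition lker : {pred P} := fun x => r x == 0.

Fact lker_submod : submod_closed lker.
Proof.
split=> [|a x y /eqP rx /eqP ry]; apply/eqP; first exact: raddf0.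
by rewrite linearP rx ry scaler0 addr0.
Qed.

Definition lker_sub : Type := {x : P | x \in lker}.
HB.instance Definition _ := [isSub of lker_sub for @sval P (fun x => x \in lker)].
HB.instance Definition _ := [Choice of lker_sub by <:].
HB.instance Definition _ :=
  GRing.SubChoice_isSubLmodule.Build A P lker lker_sub
    (GRing.submod_closed_semi lker_submod).

Fact lker_act_in (s : S) (x : lker_sub) : s ▹ (val x : P) \in lker.
Proof.
apply/eqP; rewrite slhomM (eqP (valP x)).
have [_ bDr _] := lact_balanced M.
exact: (additive_int (bDr s)).1.
Qed.

Definition lker_act (s : S) (x : lker_sub) : lker_sub :=
  exist _ (s ▹ (val x : P)) (lker_act_in s x).

Fact lker_act_balanced : balanced lker_act.
Proof.
have [bDl bDr bZ] := lact_balanced P.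
by split=> *; apply: val_inj; rewrite /= ?bDl ?bDr ?bZ.
Qed.

Fact lker_actZ a s x : lker_act (a *: s) x = a *: lker_act s x.
Proof. by apply: val_inj; rewrite /= lact_Z. Qed.

Fact lker_actA s t x : lker_act s (lker_act t x) = lker_act (s ∗ t) x.
Proof. by apply: val_inj; rewrite /= slactA. Qed.

Definition lker_slmod : slmod S :=
  slmod_build lker_act_balanced lker_actZ lker_actA.

Definition lsplit_fun (x : slmod_prod M lker_slmod) : P := i x.1 + val x.2.

Fact lsplit_linear : linear lsplit_fun.
Proof.
by move=> a x y; rewrite /lsplit_fun linearP scalerDr addrACA.
Qed.
HB.instance Definition _ := GRing.isLinear.Build A _ _ *:%R lsplit_fun lsplit_linear.

Fact lsplitM (s : S) (x : slmod_prod M lker_slmod) :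
  lsplit_fun (s ▹ x) = s ▹ lsplit_fun x.
Proof.
have -> : s ▹ x = slmod_prod_act s x by exact: slmod_buildE.
rewrite /lsplit_fun tensDr raddfD /= slhomM; congr (_ + _).
by rewrite (tliftE lker_act_balanced).
Qed.

Lemma split_sl_summand : cancel i r -> sl_summand M P.
Proof.
move=> iK; exists lker_slmod.
exists (@SLHom A S (slmod_prod M lker_slmod) P lsplit_fun lsplitM).
have rest p : p - i (r p) \in lker by apply/eqP; rewrite raddfB /= iK subrr.
exists (fun p => (r p, exist _ (p - i (r p)) (rest p))) => [[m [x xP]]|p].
  have rE : r (i m + x) = m by rewrite raddfD /= iK (eqP xP) addr0.
  congr pair; rewrite /= /lsplit_fun /= ?rE //.
  by apply: val_inj; rewrite /= /lsplit_fun /= rE addrC addKr.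
by rewrite /= /lsplit_fun /= addrC subrK.
Qed.

End Left.

(** Puts a retract of [P] in the form of a summand of a finite power, through constant families and
    evaluation at the only index. *)
Lemma split_sr_summand_pow1 (M P : srmod S) (i : srhom M P) (r : srhom P M) :
  cancel i r -> sr_summand M (srmod_pow P 'I_1).
Proof.
move=> iK.
pose j (m : M) : srmod_pow P 'I_1 := [ffun=> i m].
have jD x y : j (x + y) = j x + j y by apply/ffunP=> k; rewrite !ffunE rhomD.
have jZ x a : j (x :* a) = j x :* a by apply/ffunP=> k; rewrite !ffunE rhomZ.
have jM (m : M) (s : S) : j (m ◃ s) = j m ◃ s.
  by rewrite srmod_buildE; apply/ffunP=> k; rewrite !ffunE srhomM.
pose p (x : srmod_pow P 'I_1) : M := r ((x : {ffun 'I_1 -> P}) ord0).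
have pD x y : p (x + y) = p x + p y by rewrite /p !ffunE rhomD.
have pZ x a : p (x :* a) = p x :* a by rewrite /p !ffunE rhomZ.
have pM (x : srmod_pow P 'I_1) (s : S) : p (x ◃ s) = p x ◃ s.
  by rewrite srmod_buildE /p ffunE srhomM.
apply: (@split_sr_summand M (srmod_pow P 'I_1)
  (@SRHom A S M (srmod_pow P 'I_1) (RHom jD jZ) jM)
  (@SRHom A S (srmod_pow P 'I_1) M (RHom pD pZ) pM)).
by move=> m; rewrite /= /p ffunE iK.
Qed.

Lemma split_sl_summand_pow1 (M P : slmod S) (i : slhom M P) (r : slhom P M) :
  cancel i r -> sl_summand M (slmod_pow P 'I_1).
Proof.
move=> iK.
pose j (m : M) : slmod_pow P 'I_1 := [ffun=> i m].
have jL : linear j by move=> a x y; apply/ffunP=> k; rewrite !ffunE linearP.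
pose jl : {linear M -> slmod_pow P 'I_1} :=
  HB.pack j (GRing.isLinear.Build A _ _ *:%R j jL).
have jM (s : S) (m : M) : jl (s ▹ m) = s ▹ jl m.
  by rewrite slmod_buildE; apply/ffunP=> k; rewrite !ffunE slhomM.
pose p (x : slmod_pow P 'I_1) : M := r ((x : {ffun 'I_1 -> P}) ord0).
have pL : linear p by move=> a x y; rewrite /p !ffunE linearP.
pose pl : {linear slmod_pow P 'I_1 -> M} :=
  HB.pack p (GRing.isLinear.Build A _ _ *:%R p pL).
have pM (s : S) (x : slmod_pow P 'I_1) : pl (s ▹ x) = s ▹ pl x.
  by rewrite slmod_buildE /= /p ffunE slhomM.
apply: (@split_sl_summand M (slmod_pow P 'I_1)
  (@SLHom A S M (slmod_pow P 'I_1) jl jM)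
  (@SLHom A S (slmod_pow P 'I_1) M pl pM)).
by move=> m; rewrite /= /p ffunE iK.
Qed.

(** Associativity of the action kills the relations of the cokernel, so the value does not depend on
    the chosen representative. *)
Lemma slift_sract (M : srmod S) (x : M ⊗[A] slmod_self S) :
  @slift A S M (slmod_self S) M (sract M) (zpi (@stensor_rel A S M (slmod_self S)) x)
  = sract M x.
Proof.
have sB : zmod_morphism (sract M).
  by move=> y z; rewrite rhomD (additive_int (rhomD (sract M))).
pose h : {additive M ⊗[A] slmod_self S -> M} :=
  HB.pack (sract M : M ⊗[A] slmod_self S -> M)
    (GRing.isZmodMorphism.Build _ _ (sract M : M ⊗[A] slmod_self S -> M) sB).
by apply: (@sliftE A S M (slmod_self S) M h) => m s n; rewrite slmod_buildE /= sractA.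
Qed.

End ARingModules.

(** * Maps from A and Q to B given by pairing with the grouplike element *)

Section GrouplikeModules.
Variables (A : pzRingType) (C : coring A) (gam : cointegral C) (g : grouplike C).

Local Notation gm c c' := (gam (c ⊗ c') : A).
Local Notation g0 := (grouplike_elt g).
Local Notation B := (Bsub gam g).
Local Notation AB := (AB gam g).

Lemma gam_grouplike : gm g0 g0 = 1.
Proof. by rewrite -(grouplike_comul g) cointegral_norm grouplike_counit. Qed.

Lemma gam_grouplike_scale (a : A) : gm g0 (g0 :* a) = a.
Proof. by rewrite gamZr gam_grouplike mul1r. Qed.

Lemma grouplike_cmull (c : C) : cmul gam g0 c = g0 :* gm g0 c.
Proof. by have := grouplike_cmul gam g 1 c; rewrite rscaler1. Qed.

Lemma grouplike_Qset : g0 \in Qset gam g.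
Proof. by apply/QsetP=> c; rewrite cring_amul grouplike_cmull. Qed.

Lemma Qset_grouplike (q : C) : q \in Qset gam g -> cmul gam q g0 = q.
Proof.
by move=> /QsetP qP; rewrite -cring_amul qP gam_grouplike rscaler1.
Qed.

(** γ(gγ(ga ⊗ g) ⊗ c) = γ((ga)g ⊗ c) = γ(ga ⊗ gc), and gc = gγ(g ⊗ c) lets the scalar γ(g ⊗ c) out
    on the right. *)
Lemma Bretr_in (a : A) : gm (g0 :* a) g0 \in Bset gam g.
Proof.
apply/BsetP=> c.
by rewrite -grouplike_cmul gam_cmul grouplike_cmull gamZr.
Qed.

Definition Bretr (a : AB) : B := exist _ (gm (g0 :* (a : A)) g0) (Bretr_in a).

Lemma Bretr1 : Bretr 1 = 1.
Proof. by apply: val_inj; rewrite /= rscaler1 gam_grouplike. Qed.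

Lemma BretrD x y : Bretr (x + y) = Bretr x + Bretr y.
Proof. by apply: val_inj; rewrite /= rscaleDr gamDl. Qed.

(** Moving a across the tensor, the defining property of b applied to c = ag gives γ(gb ⊗ ag) = bγ(g
    ⊗ ag). *)
Lemma BretrZ (b : B) (a : AB) : Bretr (b *: a) = b * Bretr a.
Proof.
apply: val_inj; rewrite /= -[b *: a]/(val b * (a : A)) -rscaleA gamZ.
by have /BsetP -> := valP b; rewrite -gamZ.
Qed.

(** γ(gγ(g ⊗ q) ⊗ c) = γ(gq ⊗ c) = γ(g ⊗ qc), where qc = qγ(g ⊗ c) since q lies in Q. *)
Lemma Q_to_B_in (q : Qsub gam g) : gm g0 (val q) \in Bset gam g.
Proof.
apply/BsetP=> c; rewrite -grouplike_cmull gam_cmul -cring_amul.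
by have /QsetP -> := valP q; rewrite gamZr.
Qed.

Definition Q_to_B (q : Qsub gam g) : B := exist _ (gm g0 (val q)) (Q_to_B_in q).

Lemma Q_to_BD x y : Q_to_B (x + y) = Q_to_B x + Q_to_B y.
Proof. by apply: val_inj; rewrite /= gamDr. Qed.

Lemma Q_to_BZ (q : Qsub gam g) (b : B) : Q_to_B (q :* b) = Q_to_B q * b.
Proof. by apply: val_inj; rewrite /= gamZr. Qed.

Definition Qone : Qsub gam g := exist _ g0 grouplike_Qset.

Lemma Q_to_B1 : Q_to_B Qone = 1.
Proof. by apply: val_inj; rewrite /= gam_grouplike. Qed.

(** * The adjunction between induction and invariants, and its unit *)

Section Functor.
Variable N : rmodType B.

Section TensALift.
Variables (M : srmod (cring gam)) (f : rhom N (invariants g M)).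

Definition tensA_lift_fun (n : N) (a : AB) : M := (val (f n) : M) :* (a : A).

Fact tensA_lift_balanced : balanced tensA_lift_fun.
Proof.
split=> [n n' a|n a a'|n b a]; rewrite /tensA_lift_fun.
- by rewrite rhomD rscaleDl.
- by rewrite rscaleDr.
- by rewrite rhomZ rscaleA.
Qed.

Fact tensA_liftZ x a : tlift tensA_lift_fun (x :* a) = tlift tensA_lift_fun x :* a.
Proof.
elim/tensor_ind: x => [n b|x y xP yP].
  by rewrite tensZr !(tliftE tensA_lift_balanced) /tensA_lift_fun rscaleA.
by rewrite rscaleDl !(tliftD tensA_lift_balanced) xP yP rscaleDl.
Qed.

(** Invariance of f(n) is what is used: f(n)a · c = f(n) · ac = f(n)γ(g ⊗ ac) = f(n)γ(ga ⊗ c). *)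
Fact tensA_liftM (x : tensA N) (c : cring gam) :
  tlift tensA_lift_fun (x ◃ c) = tlift tensA_lift_fun x ◃ c.
Proof.
rewrite srmod_buildE; elim/tensor_ind: x => [n a|x y xP yP].
  rewrite tensA_actE !(tliftE tensA_lift_balanced) /tensA_lift_fun.
  by rewrite [in RHS]tensZ; have /invsetP -> := valP (f n); rewrite gamZ.
by rewrite tensA_actDl !(tliftD tensA_lift_balanced) xP yP tensDl rhomD.
Qed.

Definition tensA_lift : srhom (tensA N) M :=
  @SRHom A (cring gam) (tensA N) M
    (RHom (tliftD tensA_lift_balanced) tensA_liftZ) tensA_liftM.

Lemma tensA_liftE (n : N) (a : AB) : tensA_lift (n ⊗ a) = (val (f n) : M) :* (a : A).
Proof. exact: tliftE tensA_lift_balanced n a. Qed.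

End TensALift.

(** The elements n ⊗ 1 generate N ⊗_B A as a right A-module. *)
Lemma tensA_hom_eq (M : srmod (cring gam)) (h h' : srhom (tensA N) M) :
  (forall n : N, h (n ⊗ (1 : AB)) = h' (n ⊗ (1 : AB))) -> h = h'.
Proof.
move=> hh'; apply: srhom_ext; apply: tensor_eq; [exact: rhomD | exact: rhomD|].
move=> n a; have -> : n ⊗ a = (n ⊗ (1 : AB) : tensA N) :* (a : A).
  by rewrite tensZr; congr (_ ⊗ _); rewrite -[RHS]/(1 * (a : A)) mul1r.
by rewrite !rhomZ hh'.
Qed.

(** The inverse sends f to n ⊗ a |-> f(n)a; a map out of N ⊗_B A is recovered from its values at n ⊗
    1. *)
Lemma tensA_adjunction (M : srmod (cring gam)) :
  bijective (fun h : srhom (tensA N) M =>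
               rhom_comp (invariants_map g h) (tensA_unit N)).
Proof.
exists (@tensA_lift M) => [h|f].
  by apply: tensA_hom_eq => n; rewrite tensA_liftE /= rscaler1.
by apply: rhom_ext => n; apply: val_inj; rewrite [LHS]tensA_liftE rscaler1.
Qed.

(** Makes n ⊗ a |-> nγ(ga ⊗ g), the inverse of the unit on invariants, well defined; this rests on
    the left B-linearity of [Bretr]. *)
Fact tensA_counit_balanced : balanced (fun (n : N) (a : AB) => n :* Bretr a).
Proof.
split=> [n n' a|n a a'|n b a]; first exact: rscaleDl.
  by rewrite BretrD rscaleDr.
by rewrite BretrZ rscaleA.
Qed.

(** The scalar γ(ga ⊗ g) lies in B, so it crosses the tensor sign and leaves 1 on the right. *)
Lemma tensA_act_grouplike (t : N ⊗[B] AB) :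
  tensA_act t g0 = tlift (fun (n : N) (a : AB) => n :* Bretr a) t ⊗ (1 : AB).
Proof.
elim/tensor_ind: t => [n a|x y xP yP].
  rewrite tensA_actE (tliftE tensA_counit_balanced) [in RHS]tensZ; congr (_ ⊗ _).
  by rewrite -[RHS]/(val (Bretr a) * 1) mulr1.
by rewrite tensA_actDl (tliftD tensA_counit_balanced) xP yP tensDl.
Qed.

Lemma tensA_unit_bij : bijective (tensA_unit N).
Proof.
exists (fun t => tlift (fun (n : N) (a : AB) => n :* Bretr a) (val t)) => [n|t].
  by rewrite /= (tliftE tensA_counit_balanced) Bretr1 rscaler1.
apply: val_inj; rewrite /= -tensA_act_grouplike.
have /invsetP/(_ g0) := valP t; rewrite srmod_buildE => ->.
by rewrite gam_grouplike rscaler1.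
Qed.

(** * Firmness of the induced modules *)

Local Notation firm_pi := (zpi (@stensor_rel A (cring gam) (tensA N) (slmod_self (cring gam)))).

(** Candidate inverse of the map induced by the action, suggested by (n ⊗ 1) · ga = n ⊗ γ(g ⊗ ga) =
    n ⊗ a. *)
Definition firm_inv_fun (n : N) (a : AB) : stensor (tensA N) (slmod_self (cring gam)) :=
  firm_pi ((n ⊗ (1 : AB) : tensA N) ⊗ (g0 :* (a : A))).

Lemma firm_pi_act (x : tensA N) (c d : cring gam) :
  firm_pi ((x ◃ c) ⊗ d) = firm_pi (x ⊗ (c ∗ d)).
Proof.
apply: zpi_eq.
have := @STensor A (cring gam) (tensA N) (slmod_self (cring gam)) x c d.
by rewrite slmod_buildE.
Qed.

Fact firm_inv_balanced : balanced firm_inv_fun.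
Proof.
split=> [n n' a|n a a'|n b a]; rewrite /firm_inv_fun.
- by rewrite !tensDl zpiD.
- by rewrite rscaleDr tensDr zpiD.
(* Writing the scalar b as the action of gb allows it to pass through the cokernel relation, where
   (gb)(ga) = gγ(gb ⊗ ga) = g(ba). *)
have -> : (n :* b) ⊗ (1 : AB) = (n ⊗ (1 : AB) : tensA N) ◃ (g0 :* (val b : A)).
  rewrite srmod_buildE tensA_actE tensZ rscaler1 gam_grouplike_scale; congr (_ ⊗ _).
  by rewrite -[LHS]/(val b * 1) mulr1.
rewrite firm_pi_act cring_amul grouplike_cmul; congr (firm_pi (_ ⊗ (_ :* _))).
by have /BsetP -> := valP b; rewrite gam_grouplike_scale.
Qed.

Lemma tensA_firm : firm_srmod (tensA N).
Proof.
exists (tlift firm_inv_fun) => [s|t].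
  rewrite -[s]zreprK slift_sract; move: (zrepr s).
  apply: tensor_eq => [x y|x y|m c]; first by rewrite rhomD (tliftD firm_inv_balanced).
    exact: zpiD.
  rewrite srmod_buildE.
  elim/tensor_ind: m => [n a|x y xP yP].
    rewrite tensA_actE (tliftE firm_inv_balanced) /firm_inv_fun.
    (* Since gγ(ga ⊗ c) = (ga)c, the factor ga moves to the left of the tensor and turns n ⊗ 1 into
       n ⊗ a. *)
    rewrite -grouplike_cmul -cring_amul -firm_pi_act srmod_buildE tensA_actE.
    by rewrite rscaler1 gam_grouplike_scale.
  by rewrite tensA_actDl (tliftD firm_inv_balanced) xP yP tensDl zpiD.
elim/tensor_ind: t => [n a|x y xP yP].
  rewrite (tliftE firm_inv_balanced) slift_sract srmod_buildE tensA_actE.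
  by rewrite rscaler1 gam_grouplike_scale.
rewrite (tliftD firm_inv_balanced) -[in RHS]xP -[in RHS]yP.
(* [slift] evaluates at a chosen representative, so its additivity is obtained by writing both
   classes as images under [zpi]. *)
move: (tlift _ x) (tlift _ y) => u v.
by rewrite -[u]zreprK -[v]zreprK -zpiD !slift_sract rhomD.
Qed.

End Functor.

(** * Full faithfulness of induction *)

Lemma tensA_fully_faithful (N N' : rmodType B) :
  bijective (fun f : rhom N N' => tensA_map f).
Proof.
have [eta_inv etaK eta_invK] := tensA_unit_bij N'.
have eta_invD x y : eta_inv (x + y) = eta_inv x + eta_inv y.
  by apply: (can_inj etaK); rewrite rhomD !eta_invK.
have eta_invZ x b : eta_inv (x :* b) = eta_inv x :* b.
  by apply: (can_inj etaK); rewrite rhomZ !eta_invK.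
have mapE (f : rhom N N') (n : N) (a : AB) : tensA_map f (n ⊗ a) = f n ⊗ a.
  exact: tliftE (tensA_map_balanced f) n a.
(* The preimage of h is its transpose under the adjunction followed by the inverse of the unit at
   N'. *)
exists (fun h => rhom_comp (RHom eta_invD eta_invZ)
                  (rhom_comp (invariants_map g h) (tensA_unit N))) => [f|h].
  apply: rhom_ext => n; rewrite /= -[RHS]etaK; congr eta_inv.
  by apply: val_inj; exact: (mapE f n 1).
(* At n ⊗ 1 the claim says that the unit at N' undoes its inverse on the invariant h(n ⊗ 1). *)
apply: tensA_hom_eq => n; rewrite mapE /=.
exact: (congr1 val (eta_invK (invariants_map_fun h (tensA_unit_fun n)))).
Qed.

(** * A and Q as direct summands of C *)

Lemma A_sr_summand :
  sr_summand (A_srmod gam g) (srmod_pow (srmod_self (cring gam)) 'I_1).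
Proof.
pose i (a : A_srmod gam g) : srmod_self (cring gam) := g0 :* (a : A).
have iD x y : i (x + y) = i x + i y by exact: rscaleDr.
have iZ x a : i (x :* a) = i x :* a by rewrite /i rscaleA.
have iM (a : A_srmod gam g) (c : cring gam) : i (a ◃ c) = i a ◃ c.
  by rewrite !srmod_buildE cring_amul grouplike_cmul.
pose r (c : srmod_self (cring gam)) : A_srmod gam g := gam (g0 ⊗ (c : C)).
have rD x y : r (x + y) = r x + r y by exact: (gamDr gam g0 (x : C) y).
have rZ x a : r (x :* a) = r x :* a by exact: (gamZr gam g0 (x : C) a).
(* γ(g ⊗ cd) = γ(gc ⊗ d) = γ(gγ(g ⊗ c) ⊗ d), which is the action of d on γ(g ⊗ c). *)
have rM (c : srmod_self (cring gam)) (d : cring gam) : r (c ◃ d) = r c ◃ d.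
  by rewrite !srmod_buildE cring_amul /r /A_act -gam_cmul grouplike_cmull.
apply: (@split_sr_summand_pow1 A (cring gam) (A_srmod gam g) (srmod_self (cring gam))
  (@SRHom A (cring gam) (A_srmod gam g) (srmod_self (cring gam)) (RHom iD iZ) iM)
  (@SRHom A (cring gam) (srmod_self (cring gam)) (A_srmod gam g) (RHom rD rZ) rM)).
exact: gam_grouplike_scale.
Qed.

Lemma Q_sl_summand :
  sl_summand (Q_slmod gam g) (slmod_pow (slmod_self (cring gam)) 'I_1).
Proof.
pose i (q : Q_slmod gam g) : slmod_self (cring gam) := val (q : Qsub gam g).
have iL : linear i by move=> a x y; exact: linearP.
pose il : {linear Q_slmod gam g -> slmod_self (cring gam)} :=
  HB.pack i (GRing.isLinear.Build A _ _ *:%R i iL).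
have iM (c : cring gam) (q : Q_slmod gam g) : il (c ▹ q) = c ▹ il q.
  by rewrite !slmod_buildE.
(* Right multiplication by g lands in Q because Q is a left ideal containing g, and it fixes Q
   because g is a right unit there. *)
pose r (c : slmod_self (cring gam)) : Q_slmod gam g := Q_act (c : cring gam) Qone.
have [rD _ _] := Q_act_balanced gam g.
have rL : linear r by move=> a x y; rewrite /r rD Q_actZ.
pose rl : {linear slmod_self (cring gam) -> Q_slmod gam g} :=
  HB.pack r (GRing.isLinear.Build A _ _ *:%R r rL).
have rM (c : cring gam) (d : slmod_self (cring gam)) : rl (c ▹ d) = c ▹ rl d.
  by rewrite !slmod_buildE /= /r Q_actA.
apply: (@split_sl_summand_pow1 A (cring gam) (Q_slmod gam g) (slmod_self (cring gam))
  (@SLHom A (cring gam) (Q_slmod gam g) (slmod_self (cring gam)) il iM)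
  (@SLHom A (cring gam) (slmod_self (cring gam)) (Q_slmod gam g) rl rM)).
move=> q; apply: val_inj; rewrite /= cring_amul.
exact: Qset_grouplike (valP (q : Qsub gam g)).
Qed.

(** * Generators over B *)

Lemma A_lgenerator : lgenerator AB.
Proof.
move=> M N f h fh m.
(* Every m is the value at 1 of a B-linear map from A, so maps agreeing after composition with all
   of these agree at m. *)
pose k (a : AB) : M := Bretr a *: m.
have kL : linear k by move=> b x y; rewrite /k BretrD BretrZ scalerDl scalerA.
pose kl : {linear AB -> M} := HB.pack k (GRing.isLinear.Build B _ _ *:%R k kL).
by have := fh kl 1; rewrite /= /k Bretr1 scale1r.
Qed.

Lemma Q_rgenerator : rgenerator (Qsub gam g).
Proof.
move=> M N f h fh m.
(* Here m is the value at g, since [Q_to_B] sends g to 1. *)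
pose k (q : Qsub gam g) : M := m :* Q_to_B q.
have kD x y : k (x + y) = k x + k y by rewrite /k Q_to_BD rscaleDr.
have kZ x b : k (x :* b) = k x :* b by rewrite /k Q_to_BZ rscaleA.
by have := fh (RHom kD kZ) Qone; rewrite /= /k Q_to_B1 rscaler1.
Qed.

End GrouplikeModules.

Theorem corollary3p3 (A : pzRingType) (C : coring A) (gam : cointegral C)
    (g : grouplike C) :
  (* (1) *)
  [/\ zmod_closed (Qset gam g),
      {in Qset gam g &, forall q q' : cring gam, q ∗ q' \in Qset gam g},
      grouplike_elt g \in Qset gam g
    & {in Qset gam g, forall q : cring gam, q ∗ grouplike_elt g = q}] /\
  (* (2) *)
  [/\ forall N : rmodType (Bsub gam g), firm_srmod (tensA N),
      forall N N' : rmodType (Bsub gam g),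
        bijective (fun f : rhom N N' => tensA_map f),
      forall (N : rmodType (Bsub gam g)) (M : srmod (cring gam)), firm_srmod M ->
        bijective (fun h : srhom (tensA N) M =>
                     rhom_comp (invariants_map g h) (tensA_unit N))
    & forall N : rmodType (Bsub gam g), bijective (tensA_unit N)] /\
  (* (3) *)
  (exists n : nat,
     sr_summand (A_srmod gam g) (srmod_pow (srmod_self (cring gam)) 'I_n) /\
     sl_summand (Q_slmod gam g) (slmod_pow (slmod_self (cring gam)) 'I_n)) /\
  (* (4) *)
  lgenerator (AB gam g) /\ rgenerator (Qsub gam g).
Proof.
split; [split | split; [split | split; [|split]]].
- exact: GRing.submod_closedB (Qset_submod gam g).
(* Closure under products follows from Q being a left ideal. *)
- by move=> q q' _ Qq'; exact: (Qset_ideal q (exist _ q' Qq')).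
- exact: grouplike_Qset.
- by move=> q Qq; rewrite cring_amul Qset_grouplike.
- exact: tensA_firm.
- exact: tensA_fully_faithful.
- by move=> N M _; exact: tensA_adjunction.
- exact: tensA_unit_bij.
- by exists 1%N; split; [exact: A_sr_summand | exact: Q_sl_summand].
- exact: A_lgenerator.
- exact: Q_rgenerator.
Qed.
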